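(* Let $\alpha>0$, $\nu>-1$ and $n\in\mathbb N$. Then for $z\in\mathbb C$ $$z^{n+\nu/2}e^{-\alpha z/4}=\frac{n!}{3\pi2^{\nu+3}\alpha^{n-2}}\int_{\mathbb C}u^{\nu/2}\,I_\nu\left(\frac\alpha2\sqrt{z\overline u}\right)L^{\nu}_n\left(-\frac{\alpha u}{4}\right)e^{-\frac16\alpha\,\mathrm{Re}\,u}\,K_\nu\left(\frac{\alpha|u|}{3}\right)d\sigma(u).$$
   Context: $I_\nu$ is the modified Bessel function of the first kind, $K_\nu$ is the MacDonald function (modified Bessel function of the second kind), $L^\nu_n$ is the (generalized) Laguerre polynomial $L_n^\nu(x)=\sum_{k=0}^n\frac{(-1)^k\,\Gamma(n+\nu+1)}{(n-k)!\,\Gamma(k+\nu+1)\,k!}x^k$, and $d\sigma$ is planar Lebesgue measure on $\mathbb C$. Branches of roots and powers are principal, taken consistently: $\sqrt{z\overline u}=\sqrt z\,\overline{\sqrt u}$, $z^{\nu/2}=(\sqrt z)^\nu$, $u^{\nu/2}=(\sqrt u)^\nu$, and in $I_\nu(w)=w^\nu\cdot(\text{even entire function of }w)$ one takes $(\sqrt z\,\overline{\sqrt u})^\nu=(\sqrt z)^\nu\,\overline{(\sqrt u)^\nu}$ (equivalently, the identity is understood after cancelling $z^{\nu/2}$, where both sides become entire in $z$). *)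

(* Defs.v *)
From mathcomp Require Import all_boot all_order all_algebra.
From mathcomp Require Import all_classical all_reals all_analysis.
From mathcomp Require Export complex.

Set Implicit Arguments.
Unset Strict Implicit.
Unset Printing Implicit Defensive.

Import Order.TTheory GRing.Theory Num.Theory numFieldNormedType.Exports.
Import Normc.

Local Open Scope classical_set_scope.
Local Open Scope ring_scope.
Local Open Scope complex_scope.

Section ComplexFunctions.
Variable R : realType.
Implicit Types (z w s : R[i]) (f : R[i] -> R[i]).

Definition cexp z : R[i] :=
  (expR (complex.Re z))%:C * (cos (complex.Im z) +i* sin (complex.Im z)).

(* Principal argument, in ]-pi, pi]; its value at 0 is irrelevant. *)
Definition carg z : R :=
  if 0 <= complex.Im z then acos (complex.Re z / normc z)
  else - acos (complex.Re z / normc z).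

(* Principal power z^a = exp (a Log z) with real exponent.  At z = 0 it follows
   powR: 0^0 = 1 and 0^a = 0 for every a != 0, negative a included.
   The principal square root is the library's sqrtc (Re >= 0, and
   sqrtc (-1) = 'i), which differs from Num.sqrtC (Im >= 0).  *)
Definition cpow z (a : R) : R[i] :=
  (normc z `^ a)%:C * (cos (a * carg z) +i* sin (a * carg z)).

(* R[i]^o carries the topology of the complex modulus. *)
Definition cseries (u : nat -> R[i]) : R[i] :=
  limn (series (u : nat -> R[i]^o)).

Definition planar_integrable f : Prop :=
  let mu := (@lebesgue_measure R \x @lebesgue_measure R)%E in
  mu.-integrable setT (fun u : R * R => (complex.Re (f (u.1 +i* u.2)))%:E) /\
  mu.-integrable setT (fun u : R * R => (complex.Im (f (u.1 +i* u.2)))%:E).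

Definition planar_integral f : R[i] :=
  let mu := (@lebesgue_measure R \x @lebesgue_measure R)%E in
  (\int[mu]_(u in setT) complex.Re (f (u.1 +i* u.2)))
  +i* (\int[mu]_(u in setT) complex.Im (f (u.1 +i* u.2))).

End ComplexFunctions.

Section SpecialFunctions.
Variable R : realType.
Implicit Types (w s : R[i]) (x nu : R).

(* Euler's integral; meaningful for x > 0, the only case used when nu > -1. *)
Definition Gamma x : R :=
  \int[lebesgue_measure]_(t in `]0, +oo[) (t `^ (x - 1) * expR (- t)).

(* The entire function s |-> \sum_k s^k / (k! Gamma(k + nu + 1)), so that
   I_nu(w) = (w/2)^nu * besselI_entire nu (w^2/4). *)
Definition besselI_entire nu s : R[i] :=
  cseries (fun k => ((k`!%:R * Gamma (k%:R + nu + 1))^-1)%:C * s ^+ k).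

Definition besselI nu w : R[i] :=
  cpow (w / 2) nu * besselI_entire nu (w ^+ 2 / 4).

(* MacDonald function on x > 0, for every real order nu:
   K_nu(x) = \int_0^oo e^{- x cosh t} cosh (nu t) dt. *)
Definition besselK nu x : R :=
  let cosh t := (expR t + expR (- t)) / 2 in
  \int[lebesgue_measure]_(t in `[0, +oo[)
    (expR (- (x * cosh t)) * cosh (nu * t)).

Definition laguerre nu (n : nat) w : R[i] :=
  \sum_(k < n.+1)
    ((-1) ^+ k * Gamma (n%:R + nu + 1)
     / ((n - k)`!%:R * Gamma (k%:R + nu + 1) * k`!%:R))%:C * w ^+ k.

End SpecialFunctions.

(* Main.v *)
(* K_nu(2q) = (2 q^nu)^-1 \int exp (nu t - e^t - q^2 e^-t) dt turns the weight
   |u|^nu exp (- alpha Re u / 6) K_nu(alpha |u| / 3) into a superposition over t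
   of planar Gaussians centred at -3 e^t / alpha.  Their moments
   \int u^m (conj u)^k are explicit, and the integral over t evaluates them to
   values of Gamma.  Pairing the coefficients of L_n^nu with the k-th coefficient
   of the Bessel series, a Vandermonde convolution leaves (-4)^n binom(k, n) up
   to elementary factors: the terms k < n vanish and the others sum to
   z^n exp (- alpha z / 4).  Termwise integration is dominated convergence: the
   partial sums are O(exp (alpha |u| / 12)), which the weight absorbs. *)
From HB Require Import structures.
Require Import Defs.
From mathcomp Require Import all_boot all_order all_algebra.
From mathcomp Require Import all_classical all_reals all_analysis.
From mathcomp Require Import measurable_realfun ftc gauss_integral ring lra.
Import Order.TTheory GRing.Theory Num.Theory numFieldNormedType.Exports.
Import Normc.
Local Open Scope classical_set_scope.
Local Open Scope ring_scope.
Local Open Scope complex_scope.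

Set Implicit Arguments.
Unset Strict Implicit.
Unset Printing Implicit Defensive.

(** Since u^(nu/2) conj((sqrt u)^nu) = |u|^nu, dividing the integrand by (sqrt z)^nu leaves a
    polynomial in u, an entire function of z conj u and a positive weight: no branch survives. Two
    features of the weight decide the estimates. First, exp (- alpha Re u / 6) grows in the left
    half-plane, where the weight decays only like exp (- alpha |u| / 6) up to a power. The
    admissible growth rate alpha / 12 stays below this and is shared equally: alpha / 24 for the
    Laguerre polynomial and alpha / 24 for the Bessel sums. The latter have order 1/2 in u, so any
    positive rate suffices for them. Second, for -1 < nu <= 0 the integral over t of exp (nu t -
    e^t) diverges at -oo. A factor e^t must be gained before integrating over t: from exp (- q^2
    e^-t) when u is fixed, from the planar mass of the Gaussian when u is integrated first. Either
    way nu is replaced by nu + 1 > 0. *)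

Local Notation Re := complex.Re.
Local Notation Im := complex.Im.

(** * Integrals of complex-valued functions *)

Section ComplexParts.
Variable R : realType.
Implicit Types z w : R[i].

Lemma eq_ReIm z w : Re z = Re w -> Im z = Im w -> z = w.
Proof. by case: z w => a b [c d] /= -> ->. Qed.
Lemma ReDc z w : Re (z + w) = Re z + Re w. Proof. by case: z w => a b [c d]. Qed.
Lemma ImDc z w : Im (z + w) = Im z + Im w. Proof. by case: z w => a b [c d]. Qed.
Lemma ReNc z : Re (- z) = - Re z. Proof. by case: z. Qed.
Lemma ImNc z : Im (- z) = - Im z. Proof. by case: z. Qed.
Lemma ReMc z w : Re (z * w) = Re z * Re w - Im z * Im w.
Proof. by case: z w => a b [c d]. Qed.
Lemma ImMc z w : Im (z * w) = Re z * Im w + Im z * Re w.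
Proof. by case: z w => a b [c d]. Qed.
Lemma ReCM (x : R) z : Re (x%:C * z) = x * Re z.
Proof. by rewrite ReMc /= mul0r subr0. Qed.
Lemma ImCM (x : R) z : Im (x%:C * z) = x * Im z.
Proof. by rewrite ImMc /= mul0r addr0. Qed.
Lemma Re_sum (I : Type) (r : seq I) (P : pred I) (F : I -> R[i]) :
  Re (\sum_(i <- r | P i) F i) = \sum_(i <- r | P i) Re (F i).
Proof. by apply: (big_morph (@complex.Re R)) => //; exact: ReDc. Qed.
Lemma Im_sum (I : Type) (r : seq I) (P : pred I) (F : I -> R[i]) :
  Im (\sum_(i <- r | P i) F i) = \sum_(i <- r | P i) Im (F i).
Proof. by apply: (big_morph (@complex.Im R)) => //; exact: ImDc. Qed.

Lemma normc_ge0 z : 0 <= normc z. Proof. by case: z => a b; exact: sqrtr_ge0. Qed.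
Lemma le_Re_normc z : `|Re z| <= normc z.
Proof. by case: z => a b /=; rewrite -sqrtr_sqr ler_wsqrtr// lerDl sqr_ge0. Qed.
Lemma le_Im_normc z : `|Im z| <= normc z.
Proof. by case: z => a b /=; rewrite -sqrtr_sqr ler_wsqrtr// lerDr sqr_ge0. Qed.
Lemma normc_le_ReIm z : normc z <= `|Re z| + `|Im z|.
Proof.
case: z => a b /=; rewrite -[leRHS]ger0_norm ?addr_ge0// -sqrtr_sqr ler_wsqrtr//.
by rewrite sqrrD !real_normK ?num_real// -addrA lerD2l lerDr mulrn_wge0// mulr_ge0.
Qed.
Lemma normcR (x : R) : normc x%:C = `|x|.
Proof. by rewrite /= expr0n addr0 sqrtr_sqr. Qed.
Lemma normcX z n : normc (z ^+ n) = normc z ^+ n.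
Proof. by elim: n => [|n IH]; rewrite ?expr0 ?normc1// !exprS normcM IH. Qed.
Lemma normc_conj z : normc (conjc z) = normc z.
Proof. by case: z => a b /=; rewrite sqrrN. Qed.
Lemma le_normc_sum (I : Type) (r : seq I) (P : pred I) (F : I -> R[i]) :
  normc (\sum_(i <- r | P i) F i) <= \sum_(i <- r | P i) normc (F i).
Proof.
elim/big_rec2: _ => [|i x z _ h]; first by rewrite normc0.
by rewrite (le_trans (le_normcD _ _))// lerD2l.
Qed.

End ComplexParts.

Section ComplexIntegral.
Context d (T : measurableType d) (R : realType).
Implicit Types (f g : T -> R[i]) (c : R[i]).

Definition cmeasurable f :=
  measurable_fun setT (fun x => Re (f x)) /\
  measurable_fun setT (fun x => Im (f x)).

Lemma cmeasurable_cst c : cmeasurable (fun=> c).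
Proof. by split; exact: measurable_cst. Qed.

Lemma cmeasurable_real (f : T -> R) :
  measurable_fun setT f -> cmeasurable (fun x => (f x)%:C).
Proof. by move=> mf; split => //=; exact: measurable_cst. Qed.

Lemma cmeasurableD f g : cmeasurable f -> cmeasurable g ->
  cmeasurable (fun x => f x + g x).
Proof.
move=> [f1 f2] [g1 g2]; split.
  by under eq_fun do rewrite ReDc; exact: measurable_funD.
by under eq_fun do rewrite ImDc; exact: measurable_funD.
Qed.

Lemma cmeasurableM f g : cmeasurable f -> cmeasurable g ->
  cmeasurable (fun x => f x * g x).
Proof.
move=> [f1 f2] [g1 g2]; split.
  by under eq_fun do rewrite ReMc; apply: measurable_funB; exact: measurable_funM.
by under eq_fun do rewrite ImMc; apply: measurable_funD; exact: measurable_funM.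
Qed.

Lemma cmeasurableX f n : cmeasurable f -> cmeasurable (fun x => f x ^+ n).
Proof.
move=> mf; elim: n => [|n IH]; first exact: cmeasurable_cst.
by under eq_fun do rewrite exprS; exact: cmeasurableM.
Qed.

Lemma cmeasurable_conj f : cmeasurable f -> cmeasurable (fun x => conjc (f x)).
Proof.
move=> [f1 f2]; split.
  by rewrite (_ : (fun _ => _) = fun x => Re (f x))//; apply/funext => x; case: (f x).
rewrite (_ : (fun _ => _) = fun x => - Im (f x)).
  exact: measurableT_comp.
by apply/funext => x; case: (f x).
Qed.

Lemma cmeasurable_sum (I : Type) (r : seq I) (F : I -> T -> R[i]) :
  (forall i, cmeasurable (F i)) -> cmeasurable (fun x => \sum_(i <- r) F i x).
Proof.
move=> mF; elim: r => [|i r IH].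
  by under eq_fun do rewrite big_nil; exact: cmeasurable_cst.
by under eq_fun do rewrite big_cons; exact: cmeasurableD.
Qed.

Variable mu : {measure set T -> \bar R}.

(** For the planar product measure and a function of [cplx u], these two notions are convertible to
    [planar_integrable] and [planar_integral]; the final theorem uses this. *)
Definition cintegrable f :=
  mu.-integrable setT (fun x => (Re (f x))%:E) /\
  mu.-integrable setT (fun x => (Im (f x))%:E).

Definition cintegral f : R[i] :=
  (\int[mu]_x Re (f x)) +i* (\int[mu]_x Im (f x)).

Lemma cintegrable_le f (g : T -> R) : cmeasurable f ->
  (forall x, normc (f x) <= g x) -> mu.-integrable setT (EFin \o g) ->
  cintegrable f.
Proof.
move=> [f1 f2] fg ig; split; apply: le_integrable ig => //.
- exact/measurable_EFinP.
- move=> x _ /=; rewrite lee_fin (le_trans (le_Re_normc _))//.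
  by rewrite (le_trans (fg x))// ler_norm.
- exact/measurable_EFinP.
- move=> x _ /=; rewrite lee_fin (le_trans (le_Im_normc _))//.
  by rewrite (le_trans (fg x))// ler_norm.
Qed.

Lemma cintegrableD f g : cintegrable f -> cintegrable g ->
  cintegrable (fun x => f x + g x).
Proof.
move=> [f1 f2] [g1 g2]; split.
  by under eq_fun do rewrite ReDc EFinD; exact: integrableD.
by under eq_fun do rewrite ImDc EFinD; exact: integrableD.
Qed.

Lemma cintegralD f g : cintegrable f -> cintegrable g ->
  cintegral (fun x => f x + g x) = cintegral f + cintegral g.
Proof.
move=> [f1 f2] [g1 g2]; apply: eq_ReIm; rewrite /= ?ReDc ?ImDc /=.
  by rewrite -RintegralD//; apply: eq_Rintegral => x _; rewrite ReDc.
by rewrite -RintegralD//; apply: eq_Rintegral => x _; rewrite ImDc.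
Qed.

Lemma cintegrableZ c f : cintegrable f -> cintegrable (fun x => c * f x).
Proof.
move=> [f1 f2]; have h k (h : T -> R) : mu.-integrable setT (fun x => (h x)%:E) ->
    mu.-integrable setT (fun x => (k * h x)%:E).
  by move=> ih; under eq_fun do rewrite EFinM; exact: integrableZl.
split.
  under eq_fun do rewrite ReMc EFinB.
  by apply: integrableB => //; exact: h.
under eq_fun do rewrite ImMc EFinD.
by apply: integrableD => //; exact: h.
Qed.

Lemma cintegralZ c f : cintegrable f ->
  cintegral (fun x => c * f x) = c * cintegral f.
Proof.
move=> [f1 f2]; have h k (h : T -> R) : mu.-integrable setT (fun x => (h x)%:E) ->
    mu.-integrable setT (EFin \o (fun x => k * h x)).
  move=> ih; rewrite (_ : _ \o _ = fun x => k%:E * (h x)%:E)%E.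
    exact: integrableZl.
  by apply/funext => x /=; rewrite EFinM.
apply: eq_ReIm; rewrite ?ReMc ?ImMc /=.
  transitivity (\int[mu]_x (Re c * Re (f x) - Im c * Im (f x))).
    by apply: eq_Rintegral => x _; rewrite ReMc.
  by rewrite RintegralB ?RintegralZl//; exact: h.
transitivity (\int[mu]_x (Re c * Im (f x) + Im c * Re (f x))).
  by apply: eq_Rintegral => x _; rewrite ImMc.
by rewrite RintegralD ?RintegralZl//; exact: h.
Qed.

Lemma cintegral0 : cintegral (fun=> 0) = 0.
Proof. by rewrite /cintegral /= Rintegral_cst// mul0r. Qed.

Lemma cintegrable0 : cintegrable (fun=> 0).
Proof. by split; exact: integrable0. Qed.

Lemma cintegrable_sum (I : Type) (r : seq I) (F : I -> T -> R[i]) :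
  (forall i, cintegrable (F i)) -> cintegrable (fun x => \sum_(i <- r) F i x).
Proof.
move=> iF; elim: r => [|i r IH].
  by under eq_fun do rewrite big_nil; exact: cintegrable0.
by under eq_fun do rewrite big_cons; exact: cintegrableD.
Qed.

Lemma cintegral_sum (I : Type) (r : seq I) (F : I -> T -> R[i]) :
  (forall i, cintegrable (F i)) ->
  cintegral (fun x => \sum_(i <- r) F i x) = \sum_(i <- r) cintegral (F i).
Proof.
move=> iF; elim: r => [|i r IH].
  by under eq_fun do rewrite big_nil; rewrite big_nil cintegral0.
under eq_fun do rewrite big_cons.
by rewrite cintegralD// ?IH ?big_cons//; exact: cintegrable_sum.
Qed.

Lemma cintegral_real (f : T -> R) :
  cintegral (fun x => (f x)%:C) = (\int[mu]_x f x)%:C.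
Proof. by rewrite /cintegral /= Rintegral_cst// mul0r. Qed.

Lemma cintegrable_real (f : T -> R) :
  mu.-integrable setT (EFin \o f) -> cintegrable (fun x => (f x)%:C).
Proof. by move=> h; split => //; exact: integrable0. Qed.

Lemma Rintegral_dominated_cvg (f_ : nat -> T -> R) (f g : T -> R) :
  (forall n, measurable_fun setT (f_ n)) -> measurable_fun setT f ->
  (forall x, f_ ^~ x @ \oo --> f x) -> mu.-integrable setT (EFin \o g) ->
  (forall n x, `|f_ n x| <= g x) ->
  (fun n => \int[mu]_x f_ n x) @ \oo --> \int[mu]_x f x.
Proof.
move=> mf_ mf f_f ig fg.
have [] := @dominated_convergence _ _ _ mu setT measurableT
  (fun n x => (f_ n x)%:E) (fun x => (f x)%:E) (EFin \o g).
- by move=> n; exact/measurable_EFinP.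
- exact/measurable_EFinP.
- by apply: aeW => x _; apply: cvg_EFin; [exact: nearW|exact: f_f].
- exact: ig.
- by apply: aeW => x n _; rewrite /= lee_fin.
move=> i_f _ h; apply: fine_cvg; rewrite /= fineK//.
exact: integrable_fin_num.
Qed.

End ComplexIntegral.

Section ComplexFubini.
Context d1 d2 (T1 : measurableType d1) (T2 : measurableType d2) (R : realType).
Variable m1 : {sigma_finite_measure set T1 -> \bar R}.
Variable m2 : {sigma_finite_measure set T2 -> \bar R}.
Variable f : T1 * T2 -> R[i].
Hypothesis f_int : cintegrable (m1 \x m2)%E f.

(** Integrability is asked of every slice, so each inner extended integral is finite and [fine]
    loses nothing when the library's Fubini theorem is transferred. *)
Lemma cintegral12 : (forall x, cintegrable m2 (fun y => f (x, y))) ->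
  cintegral (m1 \x m2)%E f =
    cintegral m1 (fun x => cintegral m2 (fun y => f (x, y))) /\
  cintegrable m1 (fun x => cintegral m2 (fun y => f (x, y))).
Proof.
move: f_int => [f1 f2] h2; split.
  apply: eq_ReIm => /=; congr fine.
    rewrite -integral12_prod_meas1//; apply: eq_integral => x _.
    by rewrite /fubini_F fineK//; apply: integrable_fin_num => //; case: (h2 x).
  rewrite -integral12_prod_meas1//; apply: eq_integral => x _.
  by rewrite /fubini_F fineK//; apply: integrable_fin_num => //; case: (h2 x).
split; [have := integrable_fubini_F f1 | have := integrable_fubini_F f2];
  apply: eq_integrable => // x _; rewrite /fubini_F /= /Rintegral fineK//;
  by apply: integrable_fin_num => //; case: (h2 x).
Qed.

Lemma cintegral21 : (forall y, cintegrable m1 (fun x => f (x, y))) ->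
  cintegral (m1 \x m2)%E f =
    cintegral m2 (fun y => cintegral m1 (fun x => f (x, y))).
Proof.
move: f_int => [f1 f2] h2.
apply: eq_ReIm => /=; congr fine.
  rewrite -integral21_prod_meas1//; apply: eq_integral => x _.
  by rewrite /fubini_G fineK//; apply: integrable_fin_num => //; case: (h2 x).
rewrite -integral21_prod_meas1//; apply: eq_integral => x _.
by rewrite /fubini_G fineK//; apply: integrable_fin_num => //; case: (h2 x).
Qed.

End ComplexFubini.

(** * Gamma and Gaussian integrals *)

Section RealIntegrals.
Variable R : realType.
Local Notation mu := (@lebesgue_measure R).
Implicit Types (f : R -> R) (p a b c x t : R).

(** The source of every integration by parts below: the fundamental theorem on growing symmetric
    intervals, with [|df|] dominating the truncated integrands. *)
Lemma Rintegral_derive_eq0 (f df : R -> R) :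
  (forall x, is_derive x (1 : R) f (df x)) -> continuous df ->
  mu.-integrable setT (EFin \o df) ->
  f x @[x --> +oo] --> 0 -> f x @[x --> -oo] --> 0 ->
  \int[mu]_x df x = 0.
Proof.
move=> fdf cdf idf fy fNy.
have cf : continuous f.
  move=> x; apply/differentiable_continuous/derivable1_diffP.
  by have [] := fdf x.
(* The successor keeps the interval nondegenerate, as the fundamental theorem requires. *)
pose D n : set R := `[- n.+1%:R, n.+1%:R]%classic.
have mdf : measurable_fun setT df by exact: continuous_measurable_fun.
have h1 : (fun n => \int[mu]_x (df \_ (D n)) x) @ \oo --> \int[mu]_x df x.
  apply: (@Rintegral_dominated_cvg _ _ _ mu _ _ (fun x => `|df x|)) => //.
  - move=> n; have mD : measurable (D n) by exact: measurable_itv.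
    by apply: (iffLR (measurable_restrictT df mD)); exact: measurable_funTS.
  - move=> x; apply: cvg_near_cst; near=> n.
    rewrite patchE mem_set// /D /= in_itv /= -ler_norml.
    near: n; exists (Num.truncn `|x|) => // n /= hn.
    by rewrite (le_trans (ltW (truncnS_gt _)))// ler_nat ltnS.
  - exact: integrable_norm idf.
  - by move=> n x; rewrite patchE; case: ifP => //; rewrite normr0.
have h2 : (fun n => \int[mu]_x (df \_ (D n)) x) = fun n => f n.+1%:R - f (- n.+1%:R).
  apply/funext => n; rewrite -Rintegral_mkcond /Rintegral.
  rewrite (@continuous_FTC2 _ df f)//=.
  - by rewrite -subr_gt0 opprK -natrD ltr0n.
  - exact: continuous_subspaceT.
  - split.
    + by move=> x _; have [] := fdf x.
    + by apply: cvg_at_right_filter; exact: cf.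
    + by apply: cvg_at_left_filter; exact: cf.
  - by move=> x _; rewrite derive1E; have [] := fdf x.
have nat_y : (fun n : nat => n.+1%:R : R) @ \oo --> +oo.
  by apply/cvgrnyP; exact: (@cvg_addnl 1).
have h3 : (fun n => f n.+1%:R - f (- n.+1%:R)) @ \oo --> (0 - 0 : R).
  apply: cvgB.
    exact: (cvg_comp _ _ nat_y fy).
  apply: (cvg_comp (fun n : nat => - n.+1%:R) f); last exact: fNy.
  exact/cvgNrNy.
by move: h1; rewrite h2 => /(cvg_unique _ h3); rewrite subrr => <-.
Unshelve. all: by end_near. Qed.

Lemma ge0_integral_translate f a : (forall x, 0 <= f x) -> continuous f ->
  (\int[mu]_x (f (x + a))%:E = \int[mu]_x (f x)%:E)%E.
Proof.
move=> f0 cf.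
have dF : derive1 (fun x : R => x + a) = cst 1.
  by apply/funext => x; rewrite derive1E deriveD// derive_id derive_cst addr0.
rewrite (@increasing_ge0_integration_by_substitutionT _ (fun x => x + a) f)//.
- by apply: eq_integral => x _; rewrite dF /= fctE mulr1.
- by move=> x y xy; rewrite ltrD2r.
- by rewrite dF => x; exact: cvg_cst.
- by rewrite dF; exact: is_cvg_cst.
- by rewrite dF; exact: is_cvg_cst.
- exact: cvg_addrr_Ny.
- exact: cvg_addrr.
Qed.

Lemma ge0_integral_reflect f : (forall x, 0 <= f x) -> continuous f ->
  (\int[mu]_x (f (- x))%:E = \int[mu]_x (f x)%:E)%E.
Proof.
move=> f0 cf.
have split (g : R -> R) : (forall x, 0 <= g x) -> continuous g ->
    (\int[mu]_x (g x)%:E = \int[mu]_(x in `]-oo, 0%R]) (g x)%:E +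
      \int[mu]_(x in `[0%R, +oo[) (g x)%:E)%E.
  move=> g0 cg; have mg : measurable_fun setT (fun x => (g x)%:E).
    by apply/measurable_EFinP; exact: continuous_measurable_fun.
  rewrite -(@setUv _ `]-oo, 0%R]%classic) ge0_integral_setU//=; last 4 first.
  - exact: measurableC.
  - by rewrite setUv.
  - by move=> x _; rewrite lee_fin.
  - exact/disj_setPCl.
  congr (_ + _)%E; rewrite setCitvl integral_itv_obnd_cbnd//.
  exact: measurable_funTS.
have cfN : continuous (fun x => f (- x)).
  move=> x; apply: continuous_comp; [exact: opp_continuous | exact: cf].
rewrite [LHS]split ?[RHS]split// addeC; congr (_ + _)%E.
  have := @ge0_integration_by_substitutionNy _ f 0; rewrite oppr0 => ->//.
  exact: continuous_subspaceT.
have := @ge0_integration_by_substitutionNy _ (fun x => f (- x)) 0.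
rewrite oppr0 => ->//; last exact: continuous_subspaceT.
by apply: eq_integral => x _ /=; rewrite opprK.
Qed.

(** The common majorant on the line: gamma densities and Gaussian moments are all compared with
    it. *)
Lemma integrable_expR_Nabs p : 0 < p ->
  mu.-integrable setT (EFin \o (fun x => expR (- (p * `|x|)))).
Proof.
move=> p0.
have c1 : continuous (fun x => expR (- (p * `|x|)) : R).
  move=> x; apply: continuous_comp; last exact: continuous_expR.
  apply: continuousN; apply: continuousM; [exact: cst_continuous|exact: norm_continuous].
apply/integrableP; split.
  by apply/measurable_EFinP; exact: continuous_measurable_fun.
under eq_integral do rewrite /= ger0_norm ?expR_ge0//.
rewrite (@ge0_symfun_integralT _ (fun x => expR (- (p * `|x|))))//; last first.
  by move=> x /=; rewrite normrN.
rewrite (_ : [set x : R | 0 <= x] = `[0, +oo[%classic); last by rewrite set_itvcy.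
under eq_integral.
  move=> x; rewrite inE /= in_itv /= andbT => x0; rewrite ger0_norm//.
  over.
have dF x : is_derive x (1 : R) (fun x => - p^-1 * expR (- (p * x))) (expR (- (p * x))).
  apply: is_derive_eq; rewrite /GRing.scale /= !(mulr0, mulr1, addr0, add0r).
  by field; rewrite gt_eqF.
have cF : continuous (fun x => expR (- (p * x)) : R).
  move=> x; apply: continuous_comp; last exact: continuous_expR.
  by apply: continuousN; apply: continuousM; [exact: cst_continuous|exact: cvg_id].
rewrite (@ge0_continuous_FTC2y _ _ (fun x => - p^-1 * expR (- (p * x))) 0 0)//; last 4 first.
- exact: continuous_subspaceT.
- rewrite -[X in _ --> X](mulr0 (- p^-1)); apply: cvgM; first exact: cvg_cst.
  apply: (cvg_comp (fun x => p * x) (fun y => expR (- y))); last exact: cvgr_expR.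
  by apply: gt0_cvgMry => //; exact: cvg_id.
- by apply: cvg_at_right_filter; apply: cvgM; [exact: cvg_cst|exact: cF].
- by move=> x _; rewrite derive1E; have [] := dF x.
by rewrite -EFinB -EFinM ltry.
Qed.

Lemma cvgy_expR_Nabs f c p : 0 < p ->
  (forall x, `|f x| <= c * expR (- (p * `|x|))) -> f x @[x --> +oo] --> 0.
Proof.
move=> p0 fc; apply/norm_cvg0P.
have h : c * expR (- (p * x)) @[x --> +oo] --> (0 : R).
  rewrite -[X in _ --> X](mulr0 c); apply: cvgM; first exact: cvg_cst.
  apply: (cvg_comp (fun x => p * x) (fun y => expR (- y))); last exact: cvgr_expR.
  by apply: gt0_cvgMry => //; exact: cvg_id.
apply: (squeeze_cvgr _ (cvg_cst (0 : R)) h).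
near=> x; rewrite normr_ge0 /=.
have x0 : 0 <= x by near: x; apply: nbhs_pinfty_ge; rewrite num_real.
by have := fc x; rewrite (ger0_norm x0).
Unshelve. all: by end_near. Qed.

Lemma cvgNy_expR_Nabs f c p : 0 < p ->
  (forall x, `|f x| <= c * expR (- (p * `|x|))) -> f x @[x --> -oo] --> 0.
Proof.
move=> p0 fc; apply/cvgNy_compNP; apply: (@cvgy_expR_Nabs _ c p) => // x /=.
by have := fc (- x); rewrite normrN.
Qed.

(** One term of the exponential series. At a scaled argument it bounds a monomial by an exponential
    of arbitrarily small rate. *)
Lemma expr_le_fact_expR x n : 0 <= x -> x ^+ n <= n`!%:R * expR x.
Proof.
move=> x0; case: n => [|n].
  rewrite expr0 fact0 mul1r; apply: le_trans (expR_ge1Dx x).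
  by rewrite lerDl.
have := @expR_ge1Dxn R x n x0; rewrite -ler_pdivrMl ?ltr0n ?fact_gt0//.
by rewrite mulrC; apply: le_trans; rewrite lerDr.
Qed.

End RealIntegrals.

Section ProductIntegrable.
Context d1 d2 (T1 : measurableType d1) (T2 : measurableType d2) (R : realType).
Variable m1 : {sigma_finite_measure set T1 -> \bar R}.
Variable m2 : {sigma_finite_measure set T2 -> \bar R}.

Lemma measurable_fst_comp (f : T1 -> R) : measurable_fun setT f ->
  measurable_fun setT (fun u : T1 * T2 => f u.1).
Proof. by move=> mf; exact: (measurableT_comp mf (@measurable_fst _ _ T1 T2)). Qed.

Lemma measurable_snd_comp (f : T2 -> R) : measurable_fun setT f ->
  measurable_fun setT (fun u : T1 * T2 => f u.2).
Proof. by move=> mf; exact: (measurableT_comp mf (@measurable_snd _ _ T1 T2)). Qed.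

Lemma integrable_prod (f : T1 -> R) (g : T2 -> R) :
  m1.-integrable setT (EFin \o f) -> m2.-integrable setT (EFin \o g) ->
  (m1 \x m2)%E.-integrable setT (EFin \o (fun u => f u.1 * g u.2)).
Proof.
move=> /[dup] If /integrableP[/measurable_EFinP mf fy].
move=> /[dup] Ig /integrableP[/measurable_EFinP mg gy].
apply/integrable12ltyP.
  apply/measurable_EFinP; apply: measurable_funM.
    exact: measurable_fst_comp.
  exact: measurable_snd_comp.
have gfin : (\int[m2]_y `|(EFin \o g) y|)%E \is a fin_num.
  by rewrite ge0_fin_numE// integral_ge0.
have -> : (\int[m1]_x \int[m2]_y `|(f x * g y)%:E| =
   \int[m1]_x (`|(EFin \o f) x| * \int[m2]_y `|(EFin \o g) y|))%E.
  apply: eq_integral => x _; rewrite -ge0_integralZl//.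
  - by apply: eq_integral => y _ /=; rewrite normrM EFinM.
  - by apply: measurableT_comp => //; exact/measurable_EFinP.
rewrite ge0_integralZr//; last by rewrite integral_ge0.
  by rewrite lte_mul_pinfty// ?integral_ge0// ge0_fin_numE// integral_ge0.
by apply: measurableT_comp => //; exact/measurable_EFinP.
Qed.

Lemma Rintegral_prod (f : T1 -> R) (g : T2 -> R) :
  m1.-integrable setT (EFin \o f) -> m2.-integrable setT (EFin \o g) ->
  Rintegral (m1 \x m2)%E setT (fun u => f u.1 * g u.2) =
    (Rintegral m1 setT f) * (Rintegral m2 setT g).
Proof.
move=> If Ig; have ip := integrable_prod If Ig.
rewrite /Rintegral -integral12_prod_meas1// -fineM; last 2 first.
- exact: integrable_fin_num.
- exact: integrable_fin_num.
congr fine; rewrite -(fineK (integrable_fin_num measurableT Ig)).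
rewrite -integralZr//; apply: eq_integral => x _.
rewrite /fubini_F /= fineK; last exact: integrable_fin_num.
rewrite -integralZl//.
Qed.

End ProductIntegrable.

Section SigmaFiniteProduct.
Context d1 d2 (T1 : measurableType d1) (T2 : measurableType d2) (R : realType).
Variable m1 : {sigma_finite_measure set T1 -> \bar R}.
Variable m2 : {sigma_finite_measure set T2 -> \bar R}.

(* The library's own instance for m1 \x m2 is shadowed by the one for subprobabilities. *)
Definition sfprod : set (T1 * T2) -> \bar R := (m1 \x m2)%E.

HB.instance Definition _ := Measure.on sfprod.

Lemma sigma_finite_sfprod : sigma_finite setT sfprod.
Proof.
have /sigma_finiteP[F [TF ndF Ffin]] := sigma_finiteT m1.
have /sigma_finiteP[G [TG ndG Gfin]] := sigma_finiteT m2.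
exists (fun n => F n `*` G n).
  apply/seteqP; split => // -[x y] _.
  have [i _ Fi] : (\bigcup_k F k) x by rewrite -TF.
  have [j _ Gj] : (\bigcup_k G k) y by rewrite -TG.
  exists (maxn i j) => //; split => /=.
    by have /subsetPset := ndF _ _ (leq_maxl i j); apply.
  by have /subsetPset := ndG _ _ (leq_maxr i j); apply.
move=> n; have [mF oF] := Ffin n; have [mG oG] := Gfin n.
split; first exact: measurableX.
by rewrite /sfprod product_measure1E// lte_mul_pinfty// ge0_fin_numE.
Qed.

HB.instance Definition _ := Measure_isSigmaFinite.Build _ _ _ sfprod sigma_finite_sfprod.

End SigmaFiniteProduct.

Section GammaFunction.
Variable R : realType.
Local Notation mu := (@lebesgue_measure R).
Implicit Types (p a x t : R).

(** Euler's integrand with rate [a] after the substitution t = e^x; the Jacobian is included, hence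
    [p] instead of p - 1. *)
Definition gamma_density p a x : R := expR (p * x - a * expR x).

Lemma continuous_gamma_density p a : continuous (gamma_density p a).
Proof.
move=> x; apply: continuous_comp; last exact: continuous_expR.
apply: continuousB.
  by apply: continuousM; [exact: cst_continuous|exact: cvg_id].
by apply: continuousM; [exact: cst_continuous|exact: continuous_expR].
Qed.

Lemma measurable_gamma_density p a : measurable_fun setT (gamma_density p a).
Proof. by apply: continuous_measurable_fun; exact: continuous_gamma_density. Qed.

(** For x >= 0, e^x >= x^2 / 2 reduces the claim to the maximum of 2 p x - a x^2 / 2, which is 2 p^2
    / a; for x < 0 the term p x already is - p |x|. *)
Lemma gamma_density_le p a x : 0 < p -> 0 < a ->
  gamma_density p a x <= expR (2 * p ^+ 2 / a) * expR (- (p * `|x|)).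
Proof.
move=> p0 a0; rewrite -expRD ler_expR; have ex := expR_gt0 x.
have [x0|x0] := leP 0 x.
  have h : x ^+ 2 / 2 <= expR x.
    have := @expR_ge1Dxn R x 1 x0; rewrite (_ : 2`! = 2)//.
    by apply: le_trans; rewrite lerDr.
  have h1 : a * (x ^+ 2 / 2) <= a * expR x by rewrite ler_wpM2l// ltW.
  rewrite -subr_ge0 ger0_norm//.
  have -> : 2 * p ^+ 2 / a - p * x - (p * x - a * expR x) =
    a / 2 * (x - 2 * p / a) ^+ 2 + (a * expR x - a * (x ^+ 2 / 2)).
    by field; rewrite gt_eqF.
  by rewrite addr_ge0 ?subr_ge0// mulr_ge0 ?sqr_ge0// divr_ge0// ltW.
have : 0 <= 2 * p ^+ 2 / a by rewrite divr_ge0 ?mulr_ge0 ?sqr_ge0// ltW.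
have : 0 < a * expR x by rewrite mulr_gt0.
rewrite ltr0_norm//; lra.
Qed.

Lemma integrable_gamma_density p a : 0 < p -> 0 < a ->
  mu.-integrable setT (EFin \o gamma_density p a).
Proof.
move=> p0 a0.
have ih : mu.-integrable setT
    (fun x => (expR (2 * p ^+ 2 / a))%:E * (expR (- (p * `|x|)))%:E)%E.
  by apply: integrableZl => //; exact: integrable_expR_Nabs.
apply: le_integrable ih => //.
  by apply/measurable_EFinP; exact: measurable_gamma_density.
move=> x _ /=; rewrite lee_fin ger0_norm ?expR_ge0// ger0_norm.
  exact: gamma_density_le.
by rewrite mulr_ge0 ?expR_ge0.
Qed.

(* The substitution t = exp x in Euler's integral, on [exp (- n), exp n] first. *)
Lemma GammaE p : Gamma p = \int[mu]_x gamma_density p 1 x.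
Proof.
rewrite /Gamma /Rintegral; congr fine.
pose g t : R := expR ((p - 1) * ln t) * expR (- t).
transitivity (\int[mu]_(t in `]0%R, +oo[) (g t)%:E)%E.
  by apply: eq_integral => t; rewrite inE /= in_itv /= andbT => t0; rewrite /g /powR gt_eqF.
pose D n : set R := `[- n%:R, n%:R]%classic.
pose E n : set R := `[expR (- n%:R), expR n%:R]%classic.
have g0 t : 0 <= g t by rewrite mulr_ge0 ?expR_ge0.
have cg : {in `]0, +oo[, continuous g}.
  move=> t; rewrite in_itv /= andbT => t0.
  apply: (@continuousM _ _ (fun t => expR ((p - 1) * ln t)) (fun t => expR (- t))).
    apply: continuous_comp; last exact: continuous_expR.
    by apply: continuousM; [exact: cst_continuous|exact: continuous_ln].
  by apply: continuous_comp; [exact: opp_continuous|exact: continuous_expR].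
have cgE n : {within E n, continuous g}.
  apply: continuous_in_subspaceT => t; rewrite inE /E /= in_itv /= => /andP[h _].
  by apply: cg; rewrite in_itv /= andbT (lt_le_trans _ h)// expR_gt0.
have dE : derive1 (@expR R) = expR.
  by apply/funext => x; rewrite derive1E; have [_ ->] := is_derive_expR x.
have eq_n n : (\int[mu]_(t in E n) (g t)%:E = \int[mu]_(x in D n) (gamma_density p 1 x)%:E)%E.
  rewrite (@integration_by_substitution_increasing R expR g) ?dE//; first last.
  - exact: cgE.
  - split.
    + by move=> x _; exact: derivable_expR.
    + by apply: cvg_at_right_filter; exact: continuous_expR.
    + by apply: cvg_at_left_filter; exact: continuous_expR.
  - apply/cvg_ex; exists (expR n%:R).
    by apply: cvg_at_left_filter; exact: continuous_expR.
  - apply/cvg_ex; exists (expR (- n%:R)).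
    by apply: cvg_at_right_filter; exact: continuous_expR.
  - by move=> x _; exact: continuous_expR.
  - by move=> x y _ _; rewrite ltr_expR.
  - by rewrite ge0_cp// ler0n.
  apply: eq_integral => x _; rewrite /g /gamma_density fctE /= expRK -!expRD.
  by congr (expR _)%:E; ring.
have cE : (fun n => \int[mu]_(t in E n) (g t)%:E)%E @ \oo -->
    (\int[mu]_(t in \bigcup_n E n) (g t)%:E)%E.
  apply: ge0_nondecreasing_set_cvg_integral => //=.
  - apply/nondecreasing_seqP => n; apply/subsetPset => x; rewrite /E /= !in_itv /=.
    move=> /andP[h1 h2]; apply/andP; split.
      by apply: le_trans h1; rewrite ler_expR lerN2 ler_nat.
    by apply: (le_trans h2); rewrite ler_expR ler_nat.
  - by move=> n; exact: measurable_itv.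
  - move=> n; apply/measurable_EFinP.
    by apply: subspace_continuous_measurable_fun => //; exact: measurable_itv.
  - by move=> n x _; rewrite lee_fin.
have cD : (fun n => \int[mu]_(x in D n) (gamma_density p 1 x)%:E)%E @ \oo -->
    (\int[mu]_(t in \bigcup_n D n) (gamma_density p 1 t)%:E)%E.
  apply: ge0_nondecreasing_set_cvg_integral => //=.
  - apply/nondecreasing_seqP => n; apply/subsetPset => x; rewrite /D /= !in_itv /=.
    move=> /andP[h1 h2]; apply/andP; split.
      by apply: le_trans h1; rewrite lerN2 ler_nat.
    by apply: (le_trans h2); rewrite ler_nat.
  - by move=> n; exact: measurable_itv.
  - by move=> n; apply/measurable_EFinP/measurable_funTS; exact: measurable_gamma_density.
  - by move=> n x _; rewrite lee_fin expR_ge0.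
have UE : \bigcup_n E n = `]0, +oo[%classic.
  apply/seteqP; split => [x [n _]|x]; rewrite /E /= !in_itv /= andbT.
    by move=> /andP[h _]; rewrite (lt_le_trans _ h) ?expR_gt0.
  move=> x0; exists (Num.truncn `|ln x|).+1 => //=; rewrite in_itv /=.
  have : `|ln x| <= (Num.truncn `|ln x|).+1%:R by rewrite ltW// truncnS_gt.
  by rewrite ler_norml => /andP[h1 h2]; rewrite -[x]lnK ?posrE// !ler_expR expRK h1.
have UD : \bigcup_n D n = setT.
  apply/seteqP; split => // x _; exists (Num.truncn `|x|).+1 => //.
  by rewrite /D /= in_itv /= -ler_norml ltW// truncnS_gt.
move: cE cD; rewrite UE UD (_ : (fun n => \int[mu]_(t in E n) (g t)%:E)%E =
  (fun n => \int[mu]_(x in D n) (gamma_density p 1 x)%:E)%E).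
  move=> c1 c2.
  exact: (cvg_unique _ c1 c2).
by apply/funext => n; exact: eq_n.
Qed.

(** Translating by [ln a] absorbs the rate: it turns a^p times the density of rate [a] into the
    density of rate 1. *)
Lemma gamma_density_integral p a : 0 < p -> 0 < a ->
  \int[mu]_x gamma_density p a x = a `^ (- p) * Gamma p.
Proof.
move=> p0 a0; rewrite GammaE.
have ap0 : a `^ p != 0 by rewrite gt_eqF// powR_gt0.
have aN : a `^ (- p) * a `^ p = 1 by rewrite powRN mulVf.
have E x : gamma_density p 1 (x + ln a) = a `^ p * gamma_density p a x.
  rewrite /gamma_density /powR gt_eqF// -expRD.
  by congr expR; rewrite expRD lnK ?posrE//; ring.
have cg : continuous (gamma_density p 1) by exact: continuous_gamma_density.
have tr : (\int[mu]_x (gamma_density p 1 (x + ln a))%:E =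
    \int[mu]_x (gamma_density p 1 x)%:E)%E.
  by apply: ge0_integral_translate => // x; exact: expR_ge0.
have -> : \int[mu]_x gamma_density p 1 x = \int[mu]_x gamma_density p 1 (x + ln a).
  by rewrite /Rintegral tr.
under [X in _ = _ * X]eq_Rintegral do rewrite E.
have -> : \int[mu]_x (a `^ p * gamma_density p a x) =
    a `^ p * \int[mu]_x gamma_density p a x.
  exact: (@RintegralZl _ _ _ mu setT (gamma_density p a) (a `^ p) measurableT
    (integrable_gamma_density p0 a0)).
by rewrite mulrA aN mul1r.
Qed.

Lemma Gamma_gt0 p : 0 < p -> 0 < Gamma p.
Proof.
move=> p0; rewrite GammaE.
have ig := integrable_gamma_density p0 (@ltr01 R).
(* A lower bound of the density on [0, 1], where p x >= 0 and e^x <= e. *)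
pose c : R := expR (- expR 1).
have mg := measurable_gamma_density p 1.
have mE : measurable (`[0, 1]%classic : set R) by exact: measurable_itv.
rewrite -lte_fin /Rintegral fineK; last exact: integrable_fin_num.
apply: (@lt_le_trans _ _ (\int[mu]_(x in `[0%R, 1%R]) (gamma_density p 1 x)%:E)%E).
  apply: (@lt_le_trans _ _ (\int[mu]_(x in `[0%R, 1%R]) c%:E)%E).
    rewrite integral_cst//= lebesgue_measure_itv /= lte01 oppr0 adde0 mule1.
    by rewrite lte_fin expR_gt0.
  apply: ge0_le_integral => //.
  - by move=> x _; rewrite lee_fin expR_ge0.
  - by apply/measurable_EFinP/measurable_funTS.
  - move=> x; rewrite /= in_itv /= => /andP[x0 x1].
    rewrite lee_fin ler_expR mul1r -subr_ge0 opprK addrAC -addrA addr_ge0//.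
      by rewrite mulr_ge0// ltW.
    by rewrite subr_ge0 ler_expR.
apply: ge0_subset_integral => //.
- exact/measurable_EFinP.
- by move=> x _; rewrite lee_fin expR_ge0.
Qed.

Lemma cvgy_gamma_density p a : 0 < p -> 0 < a ->
  gamma_density p a x @[x --> +oo] --> 0.
Proof.
move=> p0 a0; apply: (cvgy_expR_Nabs p0) => x.
by rewrite ger0_norm ?expR_ge0//; exact: gamma_density_le.
Qed.

Lemma cvgNy_gamma_density p a : 0 < p -> 0 < a ->
  gamma_density p a x @[x --> -oo] --> 0.
Proof.
move=> p0 a0; apply: (cvgNy_expR_Nabs p0) => x.
by rewrite ger0_norm ?expR_ge0//; exact: gamma_density_le.
Qed.

(** The derivative of [gamma_density p 1] is [p] times itself minus [gamma_density (p + 1) 1], and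
    it integrates to zero. *)
Lemma GammaS p : 0 < p -> Gamma (p + 1) = p * Gamma p.
Proof.
move=> p0; rewrite !GammaE.
have p1 : 0 < p + 1 by rewrite addr_gt0.
have i1 := integrable_gamma_density p1 (@ltr01 R).
have i0 := integrable_gamma_density p0 (@ltr01 R).
have i0p : mu.-integrable setT (EFin \o (fun x => p * gamma_density p 1 x)).
  rewrite (_ : _ \o _ = fun x => p%:E * (EFin \o gamma_density p 1) x)%E.
    exact: integrableZl.
  by apply/funext => x.
have := @Rintegral_derive_eq0 R (gamma_density p 1)
  (fun x => p * gamma_density p 1 x - gamma_density (p + 1) 1 x).
have -> : \int[mu]_x (p * gamma_density p 1 x - gamma_density (p + 1) 1 x) =
    p * (\int[mu]_x gamma_density p 1 x) - \int[mu]_x gamma_density (p + 1) 1 x.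
  rewrite RintegralB//; congr (_ - _).
  by apply: RintegralZl.
move=> h.
apply/eqP; rewrite eq_sym -subr_eq0; apply/eqP; apply: h.
- move=> x; rewrite /gamma_density; apply: is_derive_eq.
  rewrite /GRing.scale /= !(mulr0, mulr1, addr0, add0r, mul1r, mul0r).
  rewrite (_ : (p + 1) * x - expR x = p * x - expR x + x); last by ring.
  by rewrite (expRD _ x); ring.
- move=> x; apply: (@continuousB _ _ _ (fun x => p * gamma_density p 1 x)
    (gamma_density (p + 1) 1)); last exact: continuous_gamma_density.
  by apply: continuousM; [exact: cst_continuous|exact: continuous_gamma_density].
- by rewrite (_ : _ \o _ = (fun x => (p * gamma_density p 1 x)%:E - (gamma_density (p + 1) 1 x)%:E)%E)//;
  apply: integrableB.
- by apply: cvgy_gamma_density.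
- by apply: cvgNy_gamma_density.
Qed.

End GammaFunction.

Section GaussianMoments.
Variable R : realType.
Local Notation mu := (@lebesgue_measure R).
Local Notation mu2 := (mu \x mu)%E.
Implicit Types (b c x y : R).

(** The square is left uncompleted because this is how the kernel presents itself, with [c]
    independent of t. The centre is - c / b, and completing the square produces the factor exp (c^2
    / b). *)
Definition gaussian b c x : R := expR (- (b * x ^+ 2 + 2 * c * x)).

Lemma continuous_gaussian b c : continuous (gaussian b c).
Proof.
move=> x; apply: continuous_comp; last exact: continuous_expR.
apply: continuousN; apply: continuousD.
  by apply: continuousM; [exact: cst_continuous|exact: exprn_continuous].
by apply: continuousM; [exact: cst_continuous|exact: cvg_id].
Qed.

Lemma measurable_gaussian b c : measurable_fun setT (gaussian b c).
Proof. by apply: continuous_measurable_fun; exact: continuous_gaussian. Qed.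

(** The factor exp |x| on the left will pay for polynomials, the one on the right is the remaining
    decay. The constant is the maximum of 2 (|c| + 1) r - b r^2. *)
Lemma gaussian_le b c x : 0 < b ->
  expR `|x| * gaussian b c x <= expR ((`|c| + 1) ^+ 2 / b) * expR (- (1 * `|x|)).
Proof.
move=> b0; rewrite -!expRD ler_expR -subr_ge0.
have h : - (`|c| * `|x|) <= c * x by rewrite -normrM lerNl ler_normr lexx orbT.
have -> : (`|c| + 1) ^+ 2 / b - 1 * `|x| - (`|x| - (b * x ^+ 2 + 2 * c * x)) =
  b * (`|x| - (`|c| + 1) / b) ^+ 2 + 2 * (c * x + `|c| * `|x|).
  by rewrite -[x ^+ 2]real_normK ?num_real//; field; rewrite gt_eqF.
have : 0 <= b * (`|x| - (`|c| + 1) / b) ^+ 2 by rewrite mulr_ge0 ?sqr_ge0// ltW.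
lra.
Qed.

Lemma expr_gaussian_le b c x n : 0 < b ->
  `|x ^+ n * gaussian b c x| <=
    n`!%:R * expR ((`|c| + 1) ^+ 2 / b) * expR (- (1 * `|x|)).
Proof.
move=> b0; rewrite normrM normrX (ger0_norm (expR_ge0 _)) -[leRHS]mulrA.
apply: le_trans (_ : n`!%:R * (expR `|x| * gaussian b c x) <= _).
  by rewrite [leRHS]mulrA ler_wpM2r ?expR_ge0// expr_le_fact_expR.
by rewrite ler_wpM2l// gaussian_le.
Qed.

Lemma integrable_expr_gaussian b c n : 0 < b ->
  mu.-integrable setT (EFin \o (fun x => x ^+ n * gaussian b c x)).
Proof.
move=> b0; pose k := n`!%:R * expR ((`|c| + 1) ^+ 2 / b).
have ih : mu.-integrable setT (fun x => k%:E * (expR (- (1 * `|x|)))%:E)%E.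
  by apply: integrableZl => //; exact: integrable_expR_Nabs.
apply: le_integrable ih => //.
  apply/measurable_EFinP; apply: measurable_funM; last exact: measurable_gaussian.
  exact: measurable_funX.
move=> x _ /=; rewrite lee_fin [leRHS]ger0_norm ?mulr_ge0 ?expR_ge0//.
exact: expr_gaussian_le.
Qed.

(** The integrand is the derivative of - x^n times the Gaussian. At n = 0 the predecessor is
    harmless, its coefficient being zero; the same convention recurs for the planar moments. *)
Lemma expr_gaussian_parts b c n : 0 < b ->
  \int[mu]_x ((2 * b * x + 2 * c) * x ^+ n * gaussian b c x -
    n%:R * x ^+ n.-1 * gaussian b c x) = 0.
Proof.
move=> b0; pose f x := - (x ^+ n * gaussian b c x).
have cf m : continuous (fun x => x ^+ m * gaussian b c x).
  move=> x; apply: (@continuousM _ _ (fun x => x ^+ m) (gaussian b c));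
    [exact: exprn_continuous|exact: continuous_gaussian].
apply: (@Rintegral_derive_eq0 _ f).
- move=> x; rewrite /f /gaussian.
  have dX m : is_derive x 1 (fun x : R => x ^+ m) (m%:R * x ^+ m.-1).
    have h := @is_deriveX R R^o id m x 1 1 (is_derive_id x 1).
    by move: h; rewrite exprfctE /GRing.scale /= mulr1.
  apply: is_derive_eq.
  rewrite /GRing.scale /= !(mulr0, mulr1, addr0, add0r, mul1r, mul0r) expr1.
  by set e := expR _; set q := x ^+ n.-1; set r := x ^+ n; ring.
- rewrite (_ : (fun _ => _) = (fun x => (2 * b) * (x ^+ n.+1 * gaussian b c x) +
      2 * c * (x ^+ n * gaussian b c x) - n%:R * (x ^+ n.-1 * gaussian b c x))); last first.
    by apply/funext => x; rewrite exprS; ring.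
  have h k m : continuous (fun x => k * (x ^+ m * gaussian b c x)).
    move=> x; apply: (@continuousM _ _ (fun=> k) (fun x => x ^+ m * gaussian b c x)).
      exact: cst_continuous.
    exact: cf.
  move=> x; apply: (@continuousB _ _ _ (fun x => (2 * b) * (x ^+ n.+1 * gaussian b c x) +
      2 * c * (x ^+ n * gaussian b c x)) (fun x => n%:R * (x ^+ n.-1 * gaussian b c x))).
    apply: (@continuousD _ _ _ (fun x => (2 * b) * (x ^+ n.+1 * gaussian b c x))
      (fun x => 2 * c * (x ^+ n * gaussian b c x))); exact: h.
  exact: h.
- have h m k : mu.-integrable setT (fun x => (k * (x ^+ m * gaussian b c x))%:E).
    under eq_fun do rewrite EFinM.
    by apply: integrableZl => //; exact: integrable_expr_gaussian.
  rewrite (_ : _ \o _ = (fun x => (2 * b * (x ^+ n.+1 * gaussian b c x))%:E +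
     (2 * c * (x ^+ n * gaussian b c x))%:E - (n%:R * (x ^+ n.-1 * gaussian b c x))%:E)%E).
    by apply: integrableB => //; apply: integrableD.
  by apply/funext => x /=; rewrite -?EFinB -?EFinD exprS; congr (_%:E); ring.
- apply: (@cvgy_expR_Nabs _ _ (n`!%:R * expR ((`|c| + 1) ^+ 2 / b)) 1) => // x.
  by rewrite /f normrN; exact: expr_gaussian_le.
- apply: (@cvgNy_expR_Nabs _ _ (n`!%:R * expR ((`|c| + 1) ^+ 2 / b)) 1) => // x.
  by rewrite /f normrN; exact: expr_gaussian_le.
Qed.

Lemma integral_gaussian b c : 0 < b ->
  \int[mu]_x gaussian b c x = Num.sqrt (pi / b) * expR (c ^+ 2 / b).
Proof.
(* The standard deviation of the normal law with mean - c / b that is proportional to this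
   Gaussian. *)
move=> b0; pose s := Num.sqrt (2 * b)^-1.
have s0 : s != 0 by rewrite gt_eqF// sqrtr_gt0 invr_gt0 mulr_gt0.
have s2 : s ^+ 2 = (2 * b)^-1 by rewrite sqr_sqrtr// invr_ge0 mulr_ge0// ltW.
have p0 : 0 < normal_peak s by exact: normal_peak_gt0.
have pE : Num.sqrt (pi / b) = (normal_peak s)^-1.
  rewrite /normal_peak invrK s2; congr Num.sqrt.
  by rewrite -mulr_natr; field; rewrite gt_eqF.
transitivity (\int[mu]_x (Num.sqrt (pi / b) * expR (c ^+ 2 / b) *
    normal_pdf (- (c / b)) s x)).
  apply: eq_Rintegral => x _; rewrite normal_pdfE// pE.
  rewrite mulrAC mulrA mulVf ?gt_eqF// mul1r /normal_fun -expRD /gaussian.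
  by congr expR; rewrite s2 -mulr_natr; field; rewrite gt_eqF.
set k := _ * expR _.
rewrite (@RintegralZl _ _ _ mu setT (normal_pdf (- (c / b)) s) k measurableT (integrable_normal_pdf _ _)).
by rewrite /Rintegral integral_normal_pdf /= mulr1.
Qed.

Lemma cintegrable_poly_gaussian b c (p : {poly R[i]}) : 0 < b ->
  cintegrable mu (fun x => p.[x%:C] * (gaussian b c x)%:C).
Proof.
move=> b0; under eq_fun do rewrite horner_coef mulr_suml.
apply: cintegrable_sum => i.
rewrite (_ : (fun _ => _) = fun x => p`_i * (x ^+ i * gaussian b c x)%:C).
  by apply: cintegrableZ; apply: cintegrable_real; exact: integrable_expr_gaussian.
by apply/funext => x; rewrite rmorphM rmorphXn mulrA.
Qed.

Lemma poly_gaussian_parts b c (p : {poly R[i]}) : 0 < b ->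
  cintegral mu (fun x => ((2 * b * x + 2 * c)%:C * p.[x%:C] - p^`().[x%:C]) *
    (gaussian b c x)%:C) = 0.
Proof.
move=> b0.
pose F (i : nat) x := p`_i * ((2 * b * x + 2 * c) * x ^+ i * gaussian b c x -
    i%:R * x ^+ i.-1 * gaussian b c x)%:C.
have E : (fun x => ((2 * b * x + 2 * c)%:C * p.[x%:C] - p^`().[x%:C]) *
    (gaussian b c x)%:C) = fun x => \sum_(i < size p) F i x.
  apply/funext => x.
  have dp : p^`() = \sum_(i < size p) p`_i *: ('X^(i.-1) *+ i).
    rewrite -{1}[p]coefK poly_def (big_morph _ (@derivD _) (@deriv0 _)).
    by apply: eq_bigr => i _; rewrite derivZ derivXn.
  rewrite dp horner_sum horner_coef mulr_sumr -sumrB mulr_suml.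
  apply: eq_bigr => i _; rewrite /F hornerZ hornerMn hornerXn.
  rewrite rmorphB !rmorphM /= !rmorphXn /= rmorph_nat -mulr_natl.
  ring.
have hm k m : mu.-integrable setT (fun x => (k * (x ^+ m * gaussian b c x))%:E).
  under eq_fun do rewrite EFinM.
  by apply: integrableZl => //; exact: integrable_expr_gaussian.
have iF i : cintegrable mu (fun x => ((2 * b * x + 2 * c) * x ^+ i * gaussian b c x -
    i%:R * x ^+ i.-1 * gaussian b c x)%:C).
  apply: cintegrable_real.
  rewrite (_ : _ \o _ = (fun x => (2 * b * (x ^+ i.+1 * gaussian b c x))%:E +
     (2 * c * (x ^+ i * gaussian b c x))%:E - (i%:R * (x ^+ i.-1 * gaussian b c x))%:E)%E).
    by apply: integrableB => //; apply: integrableD.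
  by apply/funext => x /=; rewrite -?EFinB -?EFinD exprS; congr (_%:E); ring.
rewrite E cintegral_sum; last by move=> i; apply: cintegrableZ.
rewrite big1// => i _; rewrite cintegralZ// cintegral_real expr_gaussian_parts//.
by rewrite mulr0.
Qed.

End GaussianMoments.

(** On a horizontal or vertical line, u and conj u are affine in the real coordinate with complex
    coefficients. The formal derivative of a complex polynomial then takes the place of
    differentiating complex-valued functions. *)
Lemma horner_linear_powers (K : comNzRingType) (a1 a2 b1 b2 t : K) k l
    (q := (a1 *: 'X + b1%:P) ^+ k * (a2 *: 'X + b2%:P) ^+ l) :
  q.[t] = (a1 * t + b1) ^+ k * (a2 * t + b2) ^+ l /\
  q^`().[t] = k%:R * a1 * (a1 * t + b1) ^+ k.-1 * (a2 * t + b2) ^+ l +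
    l%:R * a2 * (a1 * t + b1) ^+ k * (a2 * t + b2) ^+ l.-1.
Proof.
have hL (a b : K) n : ((a *: 'X + b%:P) ^+ n).[t] = (a * t + b) ^+ n.
  by rewrite horner_exp hornerD hornerZ hornerX hornerC.
have dL (a b : K) n : ((a *: 'X + b%:P) ^+ n)^`().[t] = n%:R * a * (a * t + b) ^+ n.-1.
  rewrite deriv_exp derivD derivZ derivX derivC addr0 hornerMn hornerM hL.
  by rewrite hornerZ hornerC mulr1 -mulr_natl mulrA.
by rewrite /q derivM hornerD !hornerM !hL !dL; split => //; ring.
Qed.

Lemma linear_powers_gaussian_parts (R : realType) (b c : R) (a1 a2 b1 b2 : R[i]) k l
  (F := fun x : R => ((2 * b * x + 2 * c)%:C * ((a1 * x%:C + b1) ^+ k * (a2 * x%:C + b2) ^+ l)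
     - (k%:R * a1 * (a1 * x%:C + b1) ^+ k.-1 * (a2 * x%:C + b2) ^+ l +
        l%:R * a2 * (a1 * x%:C + b1) ^+ k * (a2 * x%:C + b2) ^+ l.-1)) * (gaussian b c x)%:C) :
  0 < b -> cintegrable (@lebesgue_measure R) F /\ cintegral (@lebesgue_measure R) F = 0.
Proof.
move=> b0; pose q : {poly R[i]} := (a1 *: 'X + b1%:P) ^+ k * (a2 *: 'X + b2%:P) ^+ l.
have FE : F = fun x => ((2 * b * x + 2 * c)%:C * q.[x%:C] - q^`().[x%:C]) *
    (gaussian b c x)%:C.
  by apply/funext => x; have [h1 h2] := horner_linear_powers a1 a2 b1 b2 x%:C k l; rewrite /F h1 h2.
split; rewrite FE; last exact: poly_gaussian_parts.
have hQ (r : {poly R[i]}) (x : R) : (((2 * b)%:C *: 'X + (2 * c)%:C%:P) * r - r^`()).[x%:C] =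
    (2 * b * x + 2 * c)%:C * r.[x%:C] - r^`().[x%:C].
  rewrite hornerD hornerN hornerM hornerD hornerZ hornerX hornerC.
  by rewrite -rmorphM -rmorphD.
under eq_fun do rewrite -hQ.
exact: cintegrable_poly_gaussian.
Qed.

(** * Moments of planar Gaussians *)

Section PlanarGaussianMoments.
Variable R : realType.
Local Notation mu := (@lebesgue_measure R).
Local Notation mu2 := (mu \x mu)%E.
Variables b c : R.
Hypothesis b0 : 0 < b.

Definition cplx (u : R * R) : R[i] := u.1 +i* u.2.

Lemma cmeasurable_cplx : cmeasurable cplx.
Proof. by split; [exact: measurable_fst|exact: measurable_snd]. Qed.

(** The monomials are recentred at the centre - c / b of the Gaussian, about which it is rotation
    invariant; this is why only the moments with k = l survive. Up to a constant the weight is exp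
    (- b |u + c / b|^2). *)
Definition gmono k l (u : R * R) : R[i] :=
  (cplx u + (c / b)%:C) ^+ k * (conjc (cplx u) + (c / b)%:C) ^+ l *
  (gaussian b c u.1 * gaussian b 0 u.2)%:C.

Lemma cmeasurable_gmono k l : cmeasurable (gmono k l).
Proof.
apply: cmeasurableM; first apply: cmeasurableM.
- by apply: cmeasurableX; apply: cmeasurableD; [exact: cmeasurable_cplx|exact: cmeasurable_cst].
- apply: cmeasurableX; apply: cmeasurableD; last exact: cmeasurable_cst.
  by apply: cmeasurable_conj; exact: cmeasurable_cplx.
- apply: cmeasurable_real; apply: measurable_funM.
    exact: (measurable_fst_comp (measurable_gaussian b c)).
  exact: (measurable_snd_comp (measurable_gaussian b 0)).
Qed.

Lemma normc_cplxD_le (z w : R[i]) : normc (z + w) <= `|Re z| + `|Im z| + normc w.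
Proof. by rewrite (le_trans (le_normcD _ _))// lerD2r normc_le_ReIm. Qed.

Lemma cintegrable_gmono k l : cintegrable mu2 (gmono k l).
Proof.
pose K := (k + l)`!%:R * expR (normc (c / b)%:C) *
  (expR ((`|c| + 1) ^+ 2 / b) * expR ((`|0 : R| + 1) ^+ 2 / b)).
pose G (u : R * R) : R := K * (expR (- (1 * `|u.1|)) * expR (- (1 * `|u.2|))).
apply: (@cintegrable_le _ _ _ mu2 _ G (cmeasurable_gmono k l)).
- move=> [x y]; rewrite /gmono !normcM !normcX normcR ger0_norm; last first.
    by rewrite mulr_ge0 ?expR_ge0.
  have hA : normc (cplx (x, y) + (c / b)%:C) <= `|x| + `|y| + normc (c / b)%:C.
    exact: normc_cplxD_le.
  have hB : normc (conjc (cplx (x, y)) + (c / b)%:C) <= `|x| + `|y| + normc (c / b)%:C.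
    by apply: (le_trans (normc_cplxD_le _ _)); rewrite /= normrN.
  move: hA hB; set A := normc (_ + _); set B := normc (conjc _ + _).
  set r := normc (c / b)%:C => hA hB.
  have r0 : 0 <= r by exact: normc_ge0.
  have h1 : A ^+ k * B ^+ l <= (k + l)`!%:R * (expR `|x| * expR `|y| * expR r).
    rewrite -!expRD; apply: le_trans (expr_le_fact_expR _ _); last by rewrite !addr_ge0.
    by rewrite exprD ler_pM ?exprn_ge0 ?normc_ge0// lerXn2r// nnegrE ?normc_ge0// !addr_ge0.
  apply: le_trans (_ : (k + l)`!%:R * (expR `|x| * expR `|y| * expR r) *
     (gaussian b c x * gaussian b 0 y) <= _).
    by rewrite ler_wpM2r// mulr_ge0 ?expR_ge0.
  have -> : (k + l)`!%:R * (expR `|x| * expR `|y| * expR r) *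
     (gaussian b c x * gaussian b 0 y) = (k + l)`!%:R * expR r *
     ((expR `|x| * gaussian b c x) * (expR `|y| * gaussian b 0 y)) by ring.
  rewrite /K -[leRHS]mulrA ler_wpM2l ?mulr_ge0 ?expR_ge0//.
  rewrite [leRHS]mulrACA ler_pM ?mulr_ge0 ?expR_ge0//; exact: gaussian_le.
- have ip := @integrable_prod _ _ _ _ R mu mu _ _ (integrable_expR_Nabs (@ltr01 R))
     (integrable_expR_Nabs (@ltr01 R)).
  rewrite (_ : _ \o _ = fun u => K%:E * (expR (- (1 * `|u.1|)) * expR (- (1 * `|u.2|)))%:E)%E.
    exact: integrableZl.
  by apply/funext => u /=; rewrite !EFinM.
Qed.

Lemma cintegral_sum4 (F1 F2 F3 F4 : R * R -> R[i]) (a1 a2 a3 a4 : R[i]) :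
  cintegrable mu2 F1 -> cintegrable mu2 F2 -> cintegrable mu2 F3 ->
  cintegrable mu2 F4 ->
  let F u := a1 * F1 u + a2 * F2 u + (a3 * F3 u + a4 * F4 u) in
  cintegrable mu2 F /\
  cintegral mu2 F = a1 * cintegral mu2 F1 + a2 * cintegral mu2 F2 +
    (a3 * cintegral mu2 F3 + a4 * cintegral mu2 F4).
Proof.
move=> i1 i2 i3 i4 F; have iZ a G : cintegrable mu2 G -> cintegrable mu2 (fun u => a * G u).
  exact: cintegrableZ.
have i12 := cintegrableD (iZ a1 _ i1) (iZ a2 _ i2).
have i34 := cintegrableD (iZ a3 _ i3) (iZ a4 _ i4).
split; first exact: cintegrableD.
rewrite /F cintegralD// (cintegralD (iZ a1 _ i1) (iZ a2 _ i2)).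
by rewrite (cintegralD (iZ a3 _ i3) (iZ a4 _ i4)) !cintegralZ.
Qed.

Let M k l := cintegral mu2 (gmono k l).

Lemma gmono_partsx k l :
  b%:C * M k.+1 l + b%:C * M k l.+1 + (- k%:R * M k.-1 l + - l%:R * M k l.-1) = 0.
Proof.
have [iF <-] := cintegral_sum4 b%:C b%:C (- k%:R) (- l%:R) (cintegrable_gmono k.+1 l)
  (cintegrable_gmono k l.+1) (cintegrable_gmono k.-1 l) (cintegrable_gmono k l.-1).
set F := (fun u => _) in iF *.
pose G (y x : R) := ((2 * b * x + 2 * c)%:C *
     ((1 * x%:C + (y *i + (c / b)%:C)) ^+ k * (1 * x%:C + ((- y) *i + (c / b)%:C)) ^+ l)
     - (k%:R * 1 * (1 * x%:C + (y *i + (c / b)%:C)) ^+ k.-1 * (1 * x%:C + ((- y) *i + (c / b)%:C)) ^+ l +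
        l%:R * 1 * (1 * x%:C + (y *i + (c / b)%:C)) ^+ k * (1 * x%:C + ((- y) *i + (c / b)%:C)) ^+ l.-1)) * (gaussian b c x)%:C.
have E x y : F (x, y) = (gaussian b 0 y)%:C * G y x.
  rewrite /F /gmono /G !mul1r.
  have -> : (x%:C + (0 +i* y + (c / b)%:C)) = cplx (x, y) + (c / b)%:C.
    by apply: eq_ReIm; rewrite /= ?add0r ?addr0.
  have -> : (x%:C + (0 -i* y + (c / b)%:C)) = conjc (cplx (x, y)) + (c / b)%:C.
    by apply: eq_ReIm; rewrite /= ?add0r ?addr0.
  (* The logarithmic derivative of the Gaussian is a combination of the two recentred factors, so it
     raises one exponent or the other. *)
  have -> : (2 * b * x + 2 * c)%:C = b%:C * ((cplx (x, y) + (c / b)%:C) +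
     (conjc (cplx (x, y)) + (c / b)%:C)).
    apply: eq_ReIm; rewrite /= ?(mul0r, mulr0, addr0, add0r, subr0); last by ring.
    by field; rewrite gt_eqF.
  set A := cplx (x, y) + _; set B := conjc _ + _.
  have -> : (gaussian b c (x, y).1 * gaussian b 0 (x, y).2)%:C =
    (gaussian b c x)%:C * (gaussian b 0 y)%:C by rewrite rmorphM.
  rewrite !exprS.
  set g1 := (gaussian b c x)%:C; set g2 := (gaussian b 0 y)%:C.
  set Ak := A ^+ k; set Bl := B ^+ l; set Ak1 := A ^+ k.-1; set Bl1 := B ^+ l.-1.
  ring.
have hG y := linear_powers_gaussian_parts c 1 1 (y *i + (c / b)%:C) ((- y) *i + (c / b)%:C) k l b0.
have EF y : (fun x => F (x, y)) = fun x => (gaussian b 0 y)%:C * G y x.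
  by apply/funext => x; exact: E.
rewrite cintegral21//.
  transitivity (cintegral mu (fun _ : R => 0 : R[i])); last exact: cintegral0.
  congr cintegral; apply/funext => y; rewrite EF.
  by have [iG G0] := hG y; rewrite cintegralZ// G0 mulr0.
by move=> y; rewrite EF; have [iG _] := hG y; apply: cintegrableZ.
Qed.

Lemma gmono_partsy k l :
  - b%:C * M k.+1 l + b%:C * M k l.+1 + (- k%:R * M k.-1 l + l%:R * M k l.-1) = 0.
Proof.
have [iF <-] := cintegral_sum4 (- b%:C) b%:C (- k%:R) (l%:R) (cintegrable_gmono k.+1 l)
  (cintegrable_gmono k l.+1) (cintegrable_gmono k.-1 l) (cintegrable_gmono k l.-1).
set F := (fun u => _) in iF *.
(* An opaque copy of ['i], which [ring] can treat as an atom; the relation i^2 = -1 enters only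
   through [key]. *)
have [ii iiE] : exists ii : R[i], ii = 'i by exists 'i.
pose G (x y : R) := ((2 * b * y + 2 * 0)%:C *
     ((ii * y%:C + (x + c / b)%:C) ^+ k * (- ii * y%:C + (x + c / b)%:C) ^+ l)
     - (k%:R * ii * (ii * y%:C + (x + c / b)%:C) ^+ k.-1 * (- ii * y%:C + (x + c / b)%:C) ^+ l +
        l%:R * - ii * (ii * y%:C + (x + c / b)%:C) ^+ k * (- ii * y%:C + (x + c / b)%:C) ^+ l.-1)) * (gaussian b 0 y)%:C.
have E x y : F (x, y) = (- ii * (gaussian b c x)%:C) * G x y.
  rewrite /F /gmono /G.
  have -> : (ii * y%:C + (x + c / b)%:C) = cplx (x, y) + (c / b)%:C.
    by apply: eq_ReIm; rewrite iiE /=; ring.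
  have -> : (- ii * y%:C + (x + c / b)%:C) = conjc (cplx (x, y)) + (c / b)%:C.
    by apply: eq_ReIm; rewrite iiE /=; ring.
  have -> : (2 * b * y + 2 * 0)%:C = - ii * b%:C * ((cplx (x, y) + (c / b)%:C) -
     (conjc (cplx (x, y)) + (c / b)%:C)).
    by apply: eq_ReIm; rewrite iiE /=; ring.
  set A := cplx (x, y) + _; set B := conjc _ + _.
  have -> : (gaussian b c (x, y).1 * gaussian b 0 (x, y).2)%:C =
    (gaussian b c x)%:C * (gaussian b 0 y)%:C by rewrite rmorphM.
  rewrite !exprS.
  set g1 := (gaussian b c x)%:C; set g2 := (gaussian b 0 y)%:C.
  set Ak := A ^+ k; set Bl := B ^+ l; set Ak1 := A ^+ k.-1; set Bl1 := B ^+ l.-1.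
  have key X Y : - ii ^+ 2 * X = Y -> X = Y by move=> <-; rewrite iiE sqr_i opprK mul1r.
  apply: key.
  ring.
have hG x := linear_powers_gaussian_parts 0 ii (- ii) (x + c / b)%:C (x + c / b)%:C k l b0.
have EF x : (fun y => F (x, y)) = fun y => (- ii * (gaussian b c x)%:C) * G x y.
  by apply/funext => y; exact: E.
have [|-> _] := cintegral12 iF.
  by move=> x; rewrite EF; have [iG _] := hG x; apply: cintegrableZ.
transitivity (cintegral mu (fun _ : R => 0 : R[i])); last exact: cintegral0.
congr cintegral; apply/funext => x; rewrite EF.
by have [iG G0] := hG x; rewrite cintegralZ// G0 mulr0.
Qed.

(** Half the difference of the two relations is integration by parts for the Wirtinger derivative in
    conj u: it lowers the power of the conjugate factor, and brings down - b (u + c / b) from the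
    Gaussian. *)
Lemma gmono_rec k l : b%:C * M k.+1 l = l%:R * M k l.-1.
Proof.
have two : (2 : R[i]) != 0 by rewrite pnatr_eq0.
apply: (mulfI two); apply/eqP; rewrite -subr_eq0; apply/eqP.
transitivity ((b%:C * M k.+1 l + b%:C * M k l.+1 + (- k%:R * M k.-1 l + - l%:R * M k l.-1)) -
 (- b%:C * M k.+1 l + b%:C * M k l.+1 + (- k%:R * M k.-1 l + l%:R * M k l.-1))); first by ring.
by rewrite gmono_partsx gmono_partsy subrr.
Qed.

(** At k = 0 the sum of the two relations isolates this moment: the [k] terms vanish and the [l]
    terms cancel. *)
Lemma gmono_rec0 l : M 0 l.+1 = 0.
Proof.
have := gmono_partsx 0 l; have := gmono_partsy 0 l.
rewrite !oppr0 !mul0r !add0r => h1 h2.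
have two : (2 : R[i]) != 0 by rewrite pnatr_eq0.
have bn : b%:C != 0 :> R[i] by rewrite eq_complex /= gt_eqF.
apply: (mulfI bn); apply: (mulfI two); rewrite !mulr0 -h1 -[RHS]addr0 -h2; ring.
Qed.

Lemma gmono00 : M 0 0 = (pi / b * expR (c ^+ 2 / b))%:C.
Proof.
rewrite /M (_ : gmono 0 0 = fun u => (gaussian b c u.1 * gaussian b 0 u.2)%:C); last first.
  by apply/funext => u; rewrite /gmono !expr0 !mul1r.
have ig c' : mu.-integrable setT (EFin \o gaussian b c').
  have := @integrable_expr_gaussian R b c' 0 b0.
  by under [X in _ \o X]eq_fun do rewrite expr0 mul1r.
rewrite cintegral_real; congr _%:C.
have := @Rintegral_prod _ _ _ _ R mu mu _ _ (ig c) (ig 0).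
rewrite !integral_gaussian// => ->.
rewrite expr0n mul0r expR0 mulr1 mulrAC -expr2 sqr_sqrtr// divr_ge0 ?pi_ge0//.
exact: ltW.
Qed.

Lemma gmonoE k l : M k l =
  if k == l then (k`!%:R / b ^+ k * (pi / b * expR (c ^+ 2 / b)))%:C else 0.
Proof.
have bn : b%:C != 0 :> R[i] by rewrite eq_complex /= gt_eqF.
elim: k l => [|k IH] [|l].
- by rewrite eqxx gmono00 fact0 expr0 divr1 mul1r.
- exact: gmono_rec0.
- by apply: (mulfI bn); rewrite gmono_rec mul0r mulr0.
- rewrite eqSS; apply: (mulfI bn); rewrite gmono_rec /= IH.
  case: eqVneq => [->|_]; last by rewrite !mulr0.
  rewrite -(rmorph_nat (real_complex R)) -!rmorphM /=; congr _%:C.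
  rewrite factS natrM [b ^+ l.+1]exprS; set X := pi / b * _.
  by field; rewrite expf_neq0 ?gt_eqF.
Qed.

End PlanarGaussianMoments.

(** * The MacDonald weight as a mixture of Gaussians *)

Section MacDonald.
Variable R : realType.
Local Notation mu := (@lebesgue_measure R).
Implicit Types (nu q t x : R).

Definition macdonald_density nu q t : R :=
  expR (nu * t - expR t - q ^+ 2 * expR (- t)).

Lemma continuous_macdonald_density nu q : continuous (macdonald_density nu q).
Proof.
move=> t; apply: continuous_comp; last exact: continuous_expR.
apply: continuousB.
  apply: continuousB; last exact: continuous_expR.
  by apply: continuousM; [exact: cst_continuous|exact: cvg_id].
apply: continuousM; first exact: cst_continuous.
by apply: continuous_comp; [exact: opp_continuous|exact: continuous_expR].
Qed.

Lemma fineZl (k : R) (x : \bar R) : 0 < k -> fine (k%:E * x)%E = k * fine x.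
Proof. by move=> k0; case: x => [r||] //; rewrite ?gt0_muley ?gt0_muleNy ?lte_fin//= mulr0. Qed.

(* After unfolding cosh, t |-> t + ln q turns the two exponentials of the integrand
   into exp t and q^2 exp (- t). *)
Lemma besselKE nu q : 0 < q ->
  2 * q `^ nu * besselK nu (2 * q) = \int[mu]_t macdonald_density nu q t.
Proof.
move=> q0; rewrite /besselK /=.
pose ch t : R := (expR t + expR (- t)) / 2.
pose h t := expR (- (2 * q * ch t)) * ch (nu * t).
pose e t := expR (nu * t - q * expR t - q * expR (- t)).
have ce : continuous e.
  move=> t; apply: continuous_comp; last exact: continuous_expR.
  apply: continuousB.
    apply: continuousB; first by apply: continuousM; [exact: cst_continuous|exact: cvg_id].
    by apply: continuousM; [exact: cst_continuous|exact: continuous_expR].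
  apply: continuousM; first exact: cst_continuous.
  by apply: continuous_comp; [exact: opp_continuous|exact: continuous_expR].
have ceN : continuous (fun t => e (- t)).
  by move=> t; apply: continuous_comp; [exact: opp_continuous|exact: ce].
have e0 t : 0 <= e t by exact: expR_ge0.
have hE t : h t = 2^-1 * (e t + e (- t)).
  rewrite /h /ch /e opprK !mulrN.
  have -> : nu * t - q * expR t - q * expR (- t) = - (2 * q * ((expR t + expR (- t)) / 2)) + nu * t.
    by field.
  have -> : - (nu * t) - q * expR (- t) - q * expR t = - (2 * q * ((expR t + expR (- t)) / 2)) - nu * t.
    by field.
  by rewrite !expRD; field.
have ch' : continuous h.
  rewrite (_ : h = fun t => 2^-1 * (e t + e (- t))); last exact/funext.
  move=> t; apply: (@continuousM _ _ (fun=> 2^-1) (fun t => e t + e (- t))); first exact: cst_continuous.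
  apply: (@continuousD _ _ _ e (fun t => e (- t))); [exact: ce|exact: ceN].
have h0 t : 0 <= h t by rewrite hE mulr_ge0 ?addr_ge0.
have me : measurable_fun setT (EFin \o e).
  by apply/measurable_EFinP; exact: continuous_measurable_fun.
have meN : measurable_fun setT (EFin \o (fun t => e (- t))).
  by apply/measurable_EFinP; exact: continuous_measurable_fun.
have I1 : (2%:E * \int[mu]_(t in `[0%R, +oo[) (h t)%:E = \int[mu]_t (e t)%:E)%E.
  rewrite (_ : `[0%R, +oo[%classic = [set x : R | 0 <= x]); last by rewrite set_itvcy.
  rewrite -ge0_symfun_integralT//; last first.
    by move=> t /=; rewrite !hE opprK addrC.
  under eq_integral do rewrite hE EFinM EFinD.
  rewrite ge0_integralZl//; last 2 first.
  - exact: emeasurable_funD.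
  - by move=> t _; rewrite adde_ge0// lee_fin.
  rewrite ge0_integralD//; [|by move=> t _; rewrite lee_fin..].
  rewrite (ge0_integral_reflect e0 ce).
  rewrite -mule2n -mule_natl muleA -EFinM mulVf ?mul1e//.
have I2 : (\int[mu]_t (macdonald_density nu q t)%:E = (q `^ nu)%:E * \int[mu]_t (e t)%:E)%E.
  rewrite -(@ge0_integral_translate _ (macdonald_density nu q) (ln q)); last 2 first.
  - by move=> t; exact: expR_ge0.
  - exact: continuous_macdonald_density.
  have -> : ((q `^ nu)%:E * \int[mu]_t (e t)%:E = \int[mu]_t ((q `^ nu)%:E * (e t)%:E))%E.
    rewrite ge0_integralZl//.
      by move=> t _; rewrite lee_fin.
    by rewrite lee_fin powR_ge0.
  apply: eq_integral => t _; rewrite -EFinM /e /macdonald_density /powR gt_eqF// -expRD.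
  congr (expR _)%:E; rewrite opprD !expRD expRN lnK ?posrE// expRN lnK ?posrE//.
  by field; rewrite gt_eqF ?expR_gt0// gt_eqF.
rewrite /Rintegral I2 fineZl ?powR_gt0// -I1 fineZl// mulrA.
by rewrite [2 * _]mulrC.
Qed.

(** The factor exp (- q^2 e^-t) is traded for e^t / q^2, which raises the order to nu + 1 > 0;
    [gamma_density nu 1] alone is not integrable when nu <= 0. *)
Lemma macdonald_density_le nu q t : 0 < q ->
  macdonald_density nu q t <= (q ^+ 2)^-1 * gamma_density (nu + 1) 1 t.
Proof.
move=> q0; have q2 : 0 < q ^+ 2 by rewrite exprn_gt0.
have h : q ^+ 2 * expR (- t) <= expR (q ^+ 2 * expR (- t)).
  by apply: le_trans (expR_ge1Dx _); rewrite lerDr.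
rewrite (_ : macdonald_density nu q t = expR (nu * t - expR t) * (expR (q ^+ 2 * expR (- t)))^-1).
  rewrite (_ : gamma_density _ _ _ = expR (nu * t - expR t) * (expR (- t))^-1).
    rewrite mulrCA ler_wpM2l ?expR_ge0// -invfM lef_pV2// posrE ?expR_gt0//.
    by rewrite mulr_gt0 ?expR_gt0.
  by rewrite -expRN opprK -expRD /gamma_density; congr expR; ring.
by rewrite -expRN -expRD.
Qed.

Lemma measurable_macdonald_density nu q : measurable_fun setT (macdonald_density nu q).
Proof. by apply: continuous_measurable_fun; exact: continuous_macdonald_density. Qed.

Lemma integrable_macdonald_density nu q : 0 < q -> -1 < nu ->
  mu.-integrable setT (EFin \o macdonald_density nu q).
Proof.
move=> q0 nu1; have p0 : 0 < nu + 1 by rewrite -ltrBlDr sub0r.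
have ih : mu.-integrable setT
    (fun x => ((q ^+ 2)^-1)%:E * (EFin \o gamma_density (nu + 1) 1) x)%E.
  by apply: integrableZl => //; exact: integrable_gamma_density.
apply: le_integrable ih => //.
  by apply/measurable_EFinP; exact: measurable_macdonald_density.
move=> t _ /=; rewrite lee_fin ger0_norm ?expR_ge0//.
by rewrite (le_trans (macdonald_density_le _ _ _))// ler_norm.
Qed.

End MacDonald.

Section MacDonaldKernel.
Variable R : realType.
Local Notation mu := (@lebesgue_measure R).
Local Notation mu2 := (sfprod mu mu).
Variables alpha nu : R.
Hypotheses (alpha_gt0 : 0 < alpha) (nu_gtN1 : -1 < nu).
Implicit Types (u : R * R) (t : R).

(* On |u| > 0 this is the integrand of besselKE at q = alpha |u| / 6, times
   exp (- alpha Re u / 6); at u = 0 both K_nu and u^(nu/2) take junk values. *)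
Definition planar_density u t : R :=
  if u.1 ^+ 2 + u.2 ^+ 2 == 0 then 0 else
  expR (- (alpha / 6 * u.1)) *
  macdonald_density nu (alpha / 6 * normc (cplx u)) t.

(** A quarter of each exponent e^t and alpha^2 |u|^2 e^-t / 36 is kept here. The other three
    quarters yield decay exp (- alpha |u| / 4) by AM-GM, which pays for exp (- alpha Re u / 6) and
    for growth of rate alpha / 12, as 1/6 + 1/12 = 1/4. *)
Definition planar_majorant u t : R :=
  gamma_density nu (4^-1) t *
  (gaussian (alpha ^+ 2 / 144 * expR (- t)) 0 u.1 *
   gaussian (alpha ^+ 2 / 144 * expR (- t)) 0 u.2).

Lemma normc_cplxE u : normc (cplx u) ^+ 2 = u.1 ^+ 2 + u.2 ^+ 2.
Proof. by rewrite /= sqr_sqrtr// addr_ge0 ?sqr_ge0. Qed.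

Lemma planar_density_gaussian u t : u.1 ^+ 2 + u.2 ^+ 2 != 0 ->
  planar_density u t = gamma_density nu 1 t *
  (gaussian (alpha ^+ 2 / 36 * expR (- t)) (alpha / 12) u.1 *
   gaussian (alpha ^+ 2 / 36 * expR (- t)) 0 u.2).
Proof.
move=> /negbTE u0; rewrite /planar_density u0 /macdonald_density exprMn normc_cplxE.
rewrite /gamma_density /gaussian -!expRD; congr expR.
by field.
Qed.

Lemma planar_density_ge0 u t : 0 <= planar_density u t.
Proof. by rewrite /planar_density; case: ifP => // _; rewrite mulr_ge0 ?expR_ge0. Qed.

Lemma planar_majorant_ge0 u t : 0 <= planar_majorant u t.
Proof. by rewrite !mulr_ge0 ?expR_ge0. Qed.

Lemma planar_density_le u t :
  expR (alpha / 12 * normc (cplx u)) * planar_density u t <= planar_majorant u t.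
Proof.
rewrite /planar_density; case: ifPn => [_|u0]; first by rewrite mulr0 planar_majorant_ge0.
rewrite /planar_majorant /macdonald_density /gamma_density /gaussian -!expRD ler_expR.
set r := normc (cplx u); set s := expR t; set s' := expR (- t).
have ss : s * s' = 1 by rewrite /s /s' expRN divff// gt_eqF// expR_gt0.
have s0 : 0 < s by exact: expR_gt0.
have s'0 : 0 < s' by exact: expR_gt0.
have hx : - u.1 <= r by rewrite (le_trans (ler_norm _))// normrN (le_trans _ (le_Re_normc _)).
have rr : u.1 ^+ 2 + u.2 ^+ 2 = r ^+ 2 by rewrite normc_cplxE.
have h1 : - (alpha / 6 * u.1) <= alpha / 6 * r.
  by rewrite -mulrN ler_wpM2l// divr_ge0// ltW.
(* AM-GM: alpha r / 4 <= 3 e^t / 4 + alpha^2 r^2 e^-t / 48 *)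
have h2 : 0 <= 3 / 4 * s' * (s - alpha * r / 6) ^+ 2.
  by apply: mulr_ge0; rewrite ?sqr_ge0// mulr_ge0 ?(ltW s'0)// divr_ge0.
have h3 : 3 / 4 * s' * (s - alpha * r / 6) ^+ 2 =
    3 / 4 * s - alpha * r / 4 + alpha ^+ 2 / 48 * s' * r ^+ 2.
  rewrite (_ : 3 / 4 * s' * (s - alpha * r / 6) ^+ 2 =
    3 / 4 * (s * s') * s - (s * s') * (alpha * r) / 4 + alpha ^+ 2 / 48 * s' * r ^+ 2).
    by rewrite ss; ring.
  by field.
rewrite h3 in h2.
rewrite -subr_ge0.
have -> : nu * t - 4^-1 * s + (- (alpha ^+ 2 / 144 * s' * u.1 ^+ 2 + 2 * 0 * u.1) -
    (alpha ^+ 2 / 144 * s' * u.2 ^+ 2 + 2 * 0 * u.2)) -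
  (alpha / 12 * r + (- (alpha / 6 * u.1) + (nu * t - s - (alpha / 6 * r) ^+ 2 * s'))) =
  (3 / 4 * s - alpha * r / 4 + alpha ^+ 2 / 48 * s' * r ^+ 2) +
  (alpha / 6 * r - - (alpha / 6 * u.1)) + (alpha ^+ 2 / 144 * s' * (r ^+ 2 - (u.1 ^+ 2 + u.2 ^+ 2))).
  by field.
by rewrite rr subrr mulr0 addr0 addr_ge0// subr_ge0.
Qed.

Let b144 t : 0 < alpha ^+ 2 / 144 * expR (- t).
Proof. by rewrite mulr_gt0 ?expR_gt0// divr_gt0// exprn_gt0. Qed.

Lemma measurable_planar_majorant :
  measurable_fun setT (fun v : (R * R) * R => planar_majorant v.1 v.2).
Proof.
have mt : measurable_fun setT (fun v : (R * R) * R => v.2) by exact: measurable_snd.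
have mx : measurable_fun setT (fun v : (R * R) * R => v.1.1).
  exact: (measurable_fst_comp (@measurable_fst _ _ R R)).
have my : measurable_fun setT (fun v : (R * R) * R => v.1.2).
  exact: (measurable_fst_comp (@measurable_snd _ _ R R)).
have mg (f : (R * R) * R -> R) : measurable_fun setT f ->
  measurable_fun setT (fun v : (R * R) * R => gaussian (alpha ^+ 2 / 144 * expR (- v.2)) 0 (f v)).
  move=> mf; apply: measurableT_comp => //; apply: measurableT_comp => //.
  apply: measurable_funD.
    apply: measurable_funM; last exact: measurable_funX.
    apply: measurable_funM => //; apply: measurableT_comp => //.
    exact: measurableT_comp.
  by apply: measurable_funM.
apply: measurable_funM; last by apply: measurable_funM; exact: mg.
exact: (measurable_snd_comp (measurable_gamma_density nu 4^-1)).
Qed.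

Lemma measurable_planar_density :
  measurable_fun setT (fun v : (R * R) * R => planar_density v.1 v.2).
Proof.
have mt : measurable_fun setT (fun v : (R * R) * R => v.2) by exact: measurable_snd.
have mx : measurable_fun setT (fun v : (R * R) * R => v.1.1).
  exact: (measurable_fst_comp (@measurable_fst _ _ R R)).
have my : measurable_fun setT (fun v : (R * R) * R => v.1.2).
  exact: (measurable_fst_comp (@measurable_snd _ _ R R)).
have mr : measurable_fun setT (fun v : (R * R) * R => v.1.1 ^+ 2 + v.1.2 ^+ 2).
  by apply: measurable_funD; exact: measurable_funX.
rewrite (_ : (fun _ => _) = fun v : (R * R) * R => if v.1.1 ^+ 2 + v.1.2 ^+ 2 == 0 then 0 else
   expR (- (alpha / 6 * v.1.1)) * expR (nu * v.2 - expR v.2 -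
     (alpha ^+ 2 / 36 * (v.1.1 ^+ 2 + v.1.2 ^+ 2)) * expR (- v.2))); last first.
  apply/funext => v; rewrite /planar_density; case: ifP => // _.
  by rewrite /macdonald_density exprMn normc_cplxE; congr (_ * expR _); field.
apply: measurable_fun_ifT => //; first exact: measurable_fun_eqr.
apply: measurable_funM.
  by apply: measurableT_comp => //; apply: measurableT_comp => //; exact: measurable_funM.
apply: measurableT_comp => //; apply: measurable_funB.
  by apply: measurable_funB; [exact: measurable_funM|exact: measurableT_comp].
apply: measurable_funM; first exact: measurable_funM.
by apply: measurableT_comp => //; exact: measurableT_comp.
Qed.

(** The planar mass pi / b, with b = alpha^2 e^-t / 144, contributes the e^t that turns nu into nu +
    1 and makes the integral over t converge. *)
Lemma integrable_planar_majorant_slice t :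
  mu2.-integrable setT (EFin \o (planar_majorant ^~ t)) /\
  \int[mu2]_u planar_majorant u t = 144 * pi / alpha ^+ 2 * gamma_density (nu + 1) 4^-1 t.
Proof.
have ig : mu.-integrable setT (EFin \o gaussian (alpha ^+ 2 / 144 * expR (- t)) 0).
  have := @integrable_expr_gaussian R _ 0 0 (b144 t).
  by under [X in _ \o X]eq_fun do rewrite expr0 mul1r.
have ip := @integrable_prod _ _ _ _ R mu mu _ _ ig ig.
split.
  rewrite (_ : _ \o _ = fun u => (gamma_density nu 4^-1 t)%:E *
    (gaussian (alpha ^+ 2 / 144 * expR (- t)) 0 u.1 *
    gaussian (alpha ^+ 2 / 144 * expR (- t)) 0 u.2)%:E)%E.
    exact: integrableZl.
  by apply/funext => u.
rewrite /planar_majorant.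
rewrite (@RintegralZl _ _ _ mu2 setT _ (gamma_density nu 4^-1 t) measurableT ip).
rewrite (@Rintegral_prod _ _ _ _ R mu mu _ _ ig ig) integral_gaussian//.
rewrite expr0n mul0r expR0 mulr1 -expr2 sqr_sqrtr; last by rewrite divr_ge0 ?pi_ge0 ?ltW.
rewrite (_ : gamma_density (nu + 1) 4^-1 t = gamma_density nu 4^-1 t * (expR (- t))^-1).
  by field; rewrite !gt_eqF ?expR_gt0.
by rewrite -expRN opprK /gamma_density -expRD; congr expR; ring.
Qed.

Lemma integrable_planar_majorant :
  (mu2 \x mu)%E.-integrable setT (EFin \o (fun v => planar_majorant v.1 v.2)).
Proof.
have mD : measurable_fun setT (EFin \o (fun v : (R * R) * R => planar_majorant v.1 v.2)).
  by apply/measurable_EFinP; exact: measurable_planar_majorant.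
have key := @integrable21ltyP _ _ _ _ R mu2 mu _ mD.
apply: (iffRL key).
have p0 : 0 < nu + 1 by rewrite -ltrBlDr sub0r.
have k0 : 0 <= 144 * pi / alpha ^+ 2 by rewrite divr_ge0 ?mulr_ge0 ?pi_ge0 ?exprn_ge0 ?ltW.
have ik : mu.-integrable setT (fun t => (144 * pi / alpha ^+ 2)%:E *
    (EFin \o gamma_density (nu + 1) 4^-1) t)%E.
  by apply: integrableZl => //; exact: integrable_gamma_density.
have /integrableP[_] := ik; apply: le_lt_trans; rewrite le_eqVlt; apply/predU1P; left.
apply: eq_integral => t _; have [ij E] := integrable_planar_majorant_slice t.
transitivity ((\int[mu2]_u planar_majorant u t)%:E).
  rewrite /Rintegral fineK; last exact: integrable_fin_num.
  by apply: eq_integral => u _ /=; rewrite ger0_norm// planar_majorant_ge0.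
by rewrite E /= ger0_norm// mulr_ge0 ?expR_ge0.
Qed.

End MacDonaldKernel.

(** * Integration against the planar weight *)

Lemma real_complex_binomial (R : realType) (a b n : nat) (s : R) :
  (a%:R * b%:R * (- s) ^+ n)%:C = a%:R * b%:R * (- s%:C) ^+ n :> R[i].
Proof. by rewrite !rmorphM rmorphXn rmorphN !rmorph_nat. Qed.

Section PlanarWeight.
Variable R : realType.
Local Notation mu := (@lebesgue_measure R).
Local Notation mu2 := (sfprod mu mu).
Variables alpha nu : R.
Hypotheses (alpha_gt0 : 0 < alpha) (nu_gtN1 : -1 < nu).
Implicit Types (u : R * R) (t C : R) (f : R * R -> R[i]).

Local Notation rho := (planar_density alpha nu).

(** Off the origin this is 2 (alpha |u| / 6)^nu exp (- alpha Re u / 6) K_nu(alpha |u| / 3); at the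
    origin it is 0. *)
Definition planar_weight u : R := \int[mu]_t rho u t.

Lemma integrable_planar_density u : mu.-integrable setT (EFin \o rho u).
Proof.
have [u0|u0] := eqVneq (u.1 ^+ 2 + u.2 ^+ 2) 0.
  rewrite (_ : _ \o _ = cst 0%E); first exact: integrable0.
  by apply/funext => t; rewrite /= /planar_density u0 eqxx.
have q0 : 0 < alpha / 6 * normc (cplx u).
  rewrite mulr_gt0 ?divr_gt0// lt0r normc_ge0 andbT.
  by move: u0; rewrite -normc_cplxE expf_eq0.
rewrite (_ : _ \o _ = fun t => (expR (- (alpha / 6 * u.1)))%:E *
  (EFin \o macdonald_density nu (alpha / 6 * normc (cplx u))) t)%E.
  by apply: integrableZl => //; exact: integrable_macdonald_density.
by apply/funext => t; rewrite /= /planar_density (negbTE u0).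
Qed.

Lemma cmeasurable_fst_comp f : cmeasurable f ->
  cmeasurable (fun v : (R * R) * R => f v.1).
Proof. by move=> [f1 f2]; split; [exact: (measurable_fst_comp f1)|exact: (measurable_fst_comp f2)]. Qed.

Section Bounded.
Variables (f : R * R -> R[i]) (C : R).
Hypotheses (mf : cmeasurable f)
  (fC : forall u, normc (f u) <= C * expR (alpha / 12 * normc (cplx u))).

Let Phi (v : (R * R) * R) : R[i] := f v.1 * (rho v.1 v.2)%:C.

Let C0 : 0 <= C.
Proof.
have := fC (0, 0); rewrite -ler_pdivrMr ?expR_gt0//; apply: le_trans.
by rewrite divr_ge0 ?normc_ge0 ?expR_ge0.
Qed.

Let normc_Phi_le v : normc (Phi v) <= C * planar_majorant alpha nu v.1 v.2.
Proof.
rewrite normcM normcR ger0_norm ?planar_density_ge0//.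
apply: le_trans (_ : C * expR (alpha / 12 * normc (cplx v.1)) * rho v.1 v.2 <= _).
  by rewrite ler_wpM2r ?planar_density_ge0.
by rewrite -mulrA ler_wpM2l// planar_density_le.
Qed.

Lemma cintegrable_planar_density3 : cintegrable (mu2 \x mu)%E Phi.
Proof.
have ih : (mu2 \x mu)%E.-integrable setT
    (EFin \o (fun v => C * planar_majorant alpha nu v.1 v.2)).
  rewrite (_ : _ \o _ = fun v => C%:E * (EFin \o (fun v => planar_majorant alpha nu v.1 v.2)) v)%E.
    by apply: integrableZl => //; exact: integrable_planar_majorant.
  by apply/funext => v.
apply: (cintegrable_le _ _ ih) => //.
apply: cmeasurableM; first exact: cmeasurable_fst_comp.
by apply: cmeasurable_real; exact: measurable_planar_density.
Qed.

Lemma cintegrable_planar_densityl u : cintegrable mu (fun t => Phi (u, t)).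
Proof. 
apply: (@cintegrableZ _ _ _ mu (f u) (fun t => (rho u t)%:C)).
by apply: cintegrable_real; exact: integrable_planar_density.
Qed.

Lemma measurable_planar_densityr t : measurable_fun setT (rho ^~ t).
Proof.
exact: (measurableT_comp (measurable_planar_density alpha nu) (measurable_pair2 t)).
Qed.

Lemma cintegrable_planar_densityr t : cintegrable mu2 (fun u => Phi (u, t)).
Proof.
have [im _] := integrable_planar_majorant_slice nu alpha_gt0 t.
have ih : mu2.-integrable setT (EFin \o (fun u => C * planar_majorant alpha nu u t)).
  rewrite (_ : _ \o _ = fun u => C%:E * (EFin \o (planar_majorant alpha nu ^~ t)) u)%E.
    exact: integrableZl.
  by apply/funext => v.
apply: (cintegrable_le _ _ ih) => [|u]; last exact: (normc_Phi_le (u, t)).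
apply: cmeasurableM => //.
by apply: cmeasurable_real; exact: measurable_planar_densityr.
Qed.

(** The majorant gives joint integrability in (u, t), so Fubini used in both orders brings the
    Gaussian integral over u inside. *)
Lemma cintegral_planar_weight :
  cintegrable mu2 (fun u => f u * (planar_weight u)%:C) /\
  cintegral mu2 (fun u => f u * (planar_weight u)%:C) =
  cintegral mu (fun t => cintegral mu2 (fun u => f u * (rho u t)%:C)).
Proof.
have i3 := cintegrable_planar_density3.
have [h1 h2] := cintegral12 i3 cintegrable_planar_densityl.
have h3 := cintegral21 i3 cintegrable_planar_densityr.
have E : (fun u => cintegral mu (fun t => Phi (u, t))) = fun u => f u * (planar_weight u)%:C.
  apply/funext => u; 
  rewrite (@cintegralZ _ _ _ mu (f u) (fun t => (rho u t)%:C)) ?cintegral_real//.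
  by apply: cintegrable_real; exact: integrable_planar_density.
by rewrite E in h1 h2; split=> //; rewrite -h1 h3.
Qed.

End Bounded.

Lemma cvg_cintegral_planar_weight (f_ : nat -> R * R -> R[i]) f C :
  (forall n, cmeasurable (f_ n)) -> cmeasurable f ->
  (forall n u, normc (f_ n u) <= C * expR (alpha / 12 * normc (cplx u))) ->
  (forall u, (fun n => Re (f_ n u)) @ \oo --> Re (f u)) ->
  (forall u, (fun n => Im (f_ n u)) @ \oo --> Im (f u)) ->
  let I g := cintegral mu2 (fun u => g u * (planar_weight u)%:C) in
  (fun n => Re (I (f_ n))) @ \oo --> Re (I f) /\
  (fun n => Im (I (f_ n))) @ \oo --> Im (I f).
Proof.
move=> mf_ mf fC f_Re f_Im I.
have w0 u : 0 <= planar_weight u by apply: Rintegral_ge0 => t _; exact: planar_density_ge0.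
have mr : measurable_fun setT (fun u : R * R => normc (cplx u)).
  apply: (measurableT_comp (f := @Num.sqrt R)).
    by apply: continuous_measurable_fun; exact: sqrt_continuous.
  by apply: measurable_funD; apply: measurable_funX; [exact: measurable_fst|exact: measurable_snd].
pose g u : R := C * expR (alpha / 12 * normc (cplx u)).
have mg : measurable_fun setT g.
  by apply: measurable_funM => //; apply: measurableT_comp => //; exact: measurable_funM.
have C0 : 0 <= C.
  have := fC 0 (0, 0); rewrite -ler_pdivrMr ?expR_gt0//; apply: le_trans.
  by rewrite divr_ge0 ?normc_ge0 ?expR_ge0.
have gC u : normc (g u)%:C <= C * expR (alpha / 12 * normc (cplx u)).
  by rewrite normcR ger0_norm// mulr_ge0 ?expR_ge0.
(* The dominating function itself satisfies the growth bound, so its integrability against the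
   weight is the preceding lemma. *)
have [[ig _] _] := cintegral_planar_weight (cmeasurable_real mg) gC.
have {}ig : mu2.-integrable setT (EFin \o (fun u => g u * planar_weight u)).
  by apply: eq_integrable ig => // u _; rewrite /= mulr0 subr0.
(* Measurability of the weight is read off its integrability, that is, from the preceding lemma with
   integrand 1. *)
have mw : measurable_fun setT planar_weight.
  have oneC u : normc (1 : R[i]) <= 1 * expR (alpha / 12 * normc (cplx u)).
    rewrite normc1 mul1r -[leLHS]expR0 ler_expR.
    by rewrite mulr_ge0 ?normc_ge0// divr_ge0// ltW.
  have mone : cmeasurable (fun _ : R * R => 1 : R[i]) by exact: cmeasurable_cst.
  have [[i2 _] _] := cintegral_planar_weight mone oneC.
  have E : planar_weight = fun u => Re (1 * (planar_weight u)%:C).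
    by apply/funext => u; rewrite mul1r.
  have /measurable_EFinP h := measurable_int _ i2.
  by rewrite [X in measurable_fun _ X]E; exact: h.
have part (P : R[i] -> R) (h_ : nat -> R * R -> R[i]) (h : R * R -> R[i]) :
  (forall z x, P (z * x%:C) = P z * x) -> (forall z, `|P z| <= normc z) ->
  (forall n, measurable_fun setT (fun u => P (h_ n u))) -> measurable_fun setT (fun u => P (h u)) ->
  (forall n u, normc (h_ n u) <= g u) -> (forall u, (fun n => P (h_ n u)) @ \oo --> P (h u)) ->
  (fun n => \int[mu2]_u P (h_ n u * (planar_weight u)%:C)) @ \oo -->
    \int[mu2]_u P (h u * (planar_weight u)%:C).
  move=> PZ Pn mh_ mh hg hP.
  have mP k : measurable_fun setT (fun u => P (k u)) ->
      measurable_fun setT (fun u => P (k u * (planar_weight u)%:C)).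
    by move=> mk; under eq_fun do rewrite PZ; exact: measurable_funM.
  apply: (@Rintegral_dominated_cvg _ _ _ mu2 _ _ (fun u => g u * planar_weight u)) => //.
  - by move=> n; exact: (mP _ (mh_ n)).
  - exact: (mP _ mh).
  - move=> u; under eq_fun do rewrite PZ; rewrite PZ; apply: cvgM; first exact: hP.
    exact: cvg_cst.
  - move=> n u; rewrite PZ normrM (ger0_norm (w0 u)) ler_wpM2r//.
    exact: le_trans (Pn _) (hg _ _).
split; rewrite /I /cintegral /=; apply: part => //.
- by move=> z x; rewrite mulrC ReCM mulrC.
- exact: le_Re_normc.
- by move=> n; have [] := mf_ n.
- by have [] := mf.
- by move=> z x; rewrite mulrC ImCM mulrC.
- exact: le_Im_normc.
- by move=> n; have [] := mf_ n.
- by have [] := mf.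
Qed.

Lemma normc_monomial_le (d : R) m j : 0 < d -> forall u,
  normc (cplx u ^+ m * conjc (cplx u) ^+ j) <=
    (m + j)`!%:R / d ^+ (m + j) * expR (d * normc (cplx u)).
Proof.
move=> d0 u; rewrite normcM !normcX normc_conj -exprD mulrAC ler_pdivlMr ?exprn_gt0//.
rewrite -exprMn [normc _ * _]mulrC; apply: expr_le_fact_expR.
by rewrite mulr_ge0 ?normc_ge0// ltW.
Qed.

(** Bridges [planar_density], set to 0 at the origin, and its Gaussian form, which does not vanish
    there. *)
Lemma cintegral_ae_origin f g : cmeasurable f -> cmeasurable g ->
  (forall u, u.1 ^+ 2 + u.2 ^+ 2 != 0 -> f u = g u) ->
  cintegral mu2 f = cintegral mu2 g.
Proof.
move=> [f1 f2] [g1 g2] fg.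
have N0 : mu2 ([set 0] `*` [set 0]) = 0%E.
  rewrite /sfprod product_measure1E//.
  by rewrite [X in (X * _)%E](lebesgue_measure_set1 0) mul0e.
have ae (P : R[i] -> R) : ae_eq mu2 setT (fun u => (P (f u))%:E) (fun u => (P (g u))%:E).
  exists ([set 0] `*` [set 0]); split => //; first exact: measurableX.
  move=> u /= h; apply: contrapT => hn; apply: h => _; rewrite fg//.
  apply/negP; rewrite paddr_eq0 ?sqr_ge0// !expf_eq0 /= => /andP[/eqP u1 /eqP u2].
  by apply: hn; split.
by apply: eq_ReIm; rewrite /= /Rintegral; congr fine; apply: ae_eq_integral => //;
  try exact: ae; exact/measurable_EFinP.
Qed.

Definition planar_monomial m j u : R[i] := cplx u ^+ m * conjc (cplx u) ^+ j.

Lemma cmeasurable_planar_monomial m j : cmeasurable (planar_monomial m j).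
Proof.
apply: cmeasurableM; apply: cmeasurableX; first exact: cmeasurable_cplx.
by apply: cmeasurable_conj; exact: cmeasurable_cplx.
Qed.

(* Recentring at -s with s = c / b = 3 e^t / alpha makes the Gaussian moments diagonal. *)
Lemma planar_monomial_gaussian (b c : R) m j : 0 < b ->
  cintegrable mu2 (fun u => planar_monomial m j u *
    (gaussian b c u.1 * gaussian b 0 u.2)%:C) /\
  cintegral mu2 (fun u => planar_monomial m j u *
    (gaussian b c u.1 * gaussian b 0 u.2)%:C) =
  (\sum_(i < m.+1) 'C(m, i)%:R * 'C(j, i)%:R * (- (c / b)) ^+ (m - i + (j - i)) *
    (i`!%:R / b ^+ i * (pi / b * expR (c ^+ 2 / b))))%:C.
Proof.
move=> b0; pose s : R := c / b.
pose k (i l : nat) : R := 'C(m, i)%:R * 'C(j, l)%:R * (- s) ^+ (m - i + (j - l)).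
have -> : (fun u => planar_monomial m j u * (gaussian b c u.1 * gaussian b 0 u.2)%:C) =
   fun u => \sum_(i < m.+1) \sum_(l < j.+1) (k i l)%:C * gmono b c i l u.
  apply/funext => u; rewrite /planar_monomial.
  have -> : cplx u = - s%:C + (cplx u + s%:C) by rewrite addrC addrK.
  have -> : conjc (- s%:C + (cplx u + s%:C)) = - s%:C + (conjc (cplx u) + s%:C).
    by apply: eq_ReIm; rewrite /= ?oppr0; ring.
  rewrite !exprDn !mulr_suml; apply: eq_bigr => i _.
  rewrite mulr_sumr mulr_suml; apply: eq_bigr => l _.
  rewrite /gmono -/s.
  have -> : (k i l)%:C = 'C(m, i)%:R * 'C(j, l)%:R * ((- s%:C) ^+ (m - i) * (- s%:C) ^+ (j - l)).
    by rewrite -exprD; exact: real_complex_binomial.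
  set g := (gaussian b c u.1 * gaussian b 0 u.2)%:C.
  set A := (cplx u + _) ^+ i; set B := (_ + _) ^+ l.
  set D := _ ^+ (m - i); set E := _ ^+ (j - l); ring.
have ik i l : cintegrable mu2 (fun u => (k i l)%:C * gmono b c i l u).
  by apply: cintegrableZ; exact: cintegrable_gmono.
have ik2 (i : nat) : cintegrable mu2 (fun u => \sum_(l < j.+1) (k i l)%:C * gmono b c i l u).
  by apply: cintegrable_sum => l; exact: ik.
split; first by apply: cintegrable_sum => i; exact: ik2.
rewrite cintegral_sum => [|i]; last exact: ik2.
rewrite rmorph_sum; apply: eq_bigr => i _; rewrite cintegral_sum//.
have -> : \sum_(l < j.+1) cintegral mu2 (fun u => (k i l)%:C * gmono b c i l u) =
   \sum_(l < j.+1 | val l == i) (k i i * (i`!%:R / b ^+ i * (pi / b * expR (c ^+ 2 / b))))%:C.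
  rewrite [RHS]big_mkcond; apply: eq_bigr => l _.
  rewrite (@cintegralZ _ _ _ mu2 (k i l)%:C (gmono b c i l)); last exact: cintegrable_gmono.
  rewrite [X in _ * X](gmonoE c b0 i l) eq_sym.
  by case: eqVneq => [<-|_]; rewrite ?mulr0 -?rmorphM.
(* When i > j no index l equals i, and 'C(j, i) = 0 kills the right-hand side as well. *)
have [ij|ij] := leqP i j.
  rewrite (big_pred1 (inord i)) => [//|l /=].
  by rewrite -(inj_eq val_inj) /= inordK// ltnS.
rewrite big_pred0 => [|l]; first by rewrite (bin_small ij) mulr0n mulr0 !mul0r.
by apply/eqP => li; move: (ltn_ord l); rewrite li ltnS leqNgt ij.
Qed.

(** [p i] counts the powers of e^t: m - i + (j - i) from the centre 3 e^t / alpha, i + 1 from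
    b^-(i+1), and nu from the density. The factor exp (c^2 / b) = exp (e^t / 4) lowers the rate from
    1 to 3 / 4. *)
Lemma planar_moment m j (p := fun i : nat => nu + 1 + (m - i + (j - i) + i)%:R) :
  cintegral mu2 (fun u => planar_monomial m j u * (planar_weight u)%:C) =
  (\sum_(i < m.+1) 'C(m, i)%:R * 'C(j, i)%:R * i`!%:R * pi *
    (- (3 / alpha)) ^+ (m - i + (j - i)) * (36 / alpha ^+ 2) ^+ i.+1 *
    ((3 / 4) `^ (- p i) * Gamma (p i)))%:C.
Proof.
have d0 : 0 < alpha / 12 by rewrite divr_gt0.
have [_ ->] := cintegral_planar_weight (cmeasurable_planar_monomial m j)
  (normc_monomial_le m j d0).
have p0 i : 0 < p i by rewrite /p ltr_wpDr// -ltrBlDr sub0r.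
pose k i : R := 'C(m, i)%:R * 'C(j, i)%:R * i`!%:R * pi *
    (- (3 / alpha)) ^+ (m - i + (j - i)) * (36 / alpha ^+ 2) ^+ i.+1.
transitivity (cintegral mu (fun t => \sum_(i < m.+1) (k i)%:C * (gamma_density (p i) (3 / 4) t)%:C)).
  congr cintegral; apply/funext => t.
  pose b := alpha ^+ 2 / 36 * expR (- t); pose c := alpha / 12.
  have e0 := expR_gt0 t.
  have b0 : 0 < b by rewrite mulr_gt0 ?expR_gt0// divr_gt0// exprn_gt0.
  have bE : b^-1 = 36 / alpha ^+ 2 * expR t.
    by rewrite /b expRN; field; rewrite !gt_eqF.
  pose G u := gaussian b c u.1 * gaussian b 0 u.2.
  have mG : measurable_fun setT G.
    apply: measurable_funM; first exact: (measurable_fst_comp (measurable_gaussian b c)).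
    exact: (measurable_snd_comp (measurable_gaussian b 0)).
  rewrite (@cintegral_ae_origin _ (fun u => (gamma_density nu 1 t)%:C * (planar_monomial m j u * (G u)%:C))).
  - have [iG vG] := planar_monomial_gaussian c m j b0.
    rewrite (@cintegralZ _ _ _ mu2 (gamma_density nu 1 t)%:C (fun u => planar_monomial m j u * (G u)%:C))//.
    rewrite [X in _ * X]vG -rmorphM mulr_sumr rmorph_sum.
    apply: eq_bigr => i _; rewrite -[RHS](rmorphM (real_complex R)).
    apply: (congr1 (real_complex R)).
    rewrite /k (_ : c / b = 3 / alpha * expR t); last first.
      by rewrite bE /c; field; rewrite gt_eqF.
    rewrite (_ : c ^+ 2 / b = expR t / 4); last by rewrite bE /c; field; rewrite gt_eqF.
    rewrite -exprVn bE -mulNr exprMn [(_ * expR t) ^+ i]exprMn.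
    have -> : gamma_density (p i) (3 / 4) t = gamma_density nu 1 t *
       (expR t ^+ (m - i + (j - i)) * expR t ^+ i.+1 * expR (expR t / 4)).
      rewrite -!expRM_natl -!expRD /gamma_density /p; congr expR.
      by rewrite -natr1 (natrD _ (m - i + (j - i)) i); field.
    set e1 := expR t ^+ _; set e2 := expR (_ / 4); set g := gamma_density _ _ _.
    set e3 := _ ^+ (m - i + _).
    rewrite (exprS _ i) (exprS (expR t) i); ring.
  - apply: cmeasurableM; first exact: cmeasurable_planar_monomial.
    by apply: cmeasurable_real; exact: measurable_planar_densityr.
  - apply: cmeasurableM; first exact: cmeasurable_cst.
    apply: cmeasurableM; first exact: cmeasurable_planar_monomial.
    exact: cmeasurable_real.
  - move=> u u0; rewrite planar_density_gaussian// rmorphM -/(G u); ring.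
rewrite cintegral_sum => [|i]; last first.
  by apply: cintegrableZ; apply: cintegrable_real; apply: integrable_gamma_density.
rewrite rmorph_sum; apply: eq_bigr => i _.
rewrite (@cintegralZ _ _ _ mu (k i)%:C (fun t => (gamma_density (p i) (3 / 4) t)%:C)).
  rewrite cintegral_real gamma_density_integral//.
  exact: (esym (rmorphM (real_complex R) _ _)).
by apply: cintegrable_real; apply: integrable_gamma_density.
Qed.

End PlanarWeight.

(** * The Laguerre moment identity *)

Section FallingFactorial.
Variable R : realType.
Implicit Types (x y : R).

Definition ffactr x k : R := \prod_(i < k) (x - i%:R).

Lemma ffactr0 x : ffactr x 0 = 1. Proof. by rewrite /ffactr big_ord0. Qed.

Lemma ffactrS x k : ffactr x k.+1 = ffactr x k * (x - k%:R).
Proof. by rewrite /ffactr big_ord_recr. Qed.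

Lemma ffactrSl x k : ffactr (x + 1) k.+1 = (x + 1) * ffactr x k.
Proof.
rewrite /ffactr big_ord_recl subr0; congr (_ * _); apply: eq_bigr => i _.
by rewrite lift0 -natr1; ring.
Qed.

Lemma ffactr_nat m k : ffactr m%:R k = (m ^_ k)%:R.
Proof.
elim: k m => [|k IH] m; first by rewrite ffactr0.
case: m => [|m]; first by rewrite /ffactr big_ord_recl subrr mul0r.
by rewrite -natr1 ffactrSl IH ffactSS natrM natr1.
Qed.

Lemma ffactr_reflect x k : ffactr x k = (-1) ^+ k * ffactr (k%:R - 1 - x) k.
Proof.
transitivity (\prod_(i < k) (-1 * (k%:R - 1 - x - (rev_ord i)%:R))).
  by apply: eq_bigr => i _ /=; rewrite natrB// -natr1; ring.
rewrite big_split prodr_const card_ord /ffactr; congr (_ * _).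
by rewrite [RHS](reindex_inj rev_ord_inj).
Qed.

Lemma ffactr_Vandermonde x y n :
  \sum_(p < n.+1) 'C(n, p)%:R * (ffactr x (n - p) * ffactr y p) = ffactr (x + y) n.
Proof.
elim: n => [|n IH]; first by rewrite big_ord1 !ffactr0 bin0 !mul1r.
rewrite ffactrS -IH mulr_suml.
have E1 : \sum_(p < n.+2) 'C(n.+1, p)%:R * (ffactr x (n.+1 - p) * ffactr y p) =
  \sum_(p < n.+1) 'C(n, p)%:R * (ffactr x (n.+1 - p) * ffactr y p) +
  \sum_(p < n.+1) 'C(n, p)%:R * (ffactr x (n - p) * ffactr y p.+1).
  have -> : \sum_(p < n.+1) 'C(n, p)%:R * (ffactr x (n.+1 - p) * ffactr y p) =
      \sum_(p < n.+2) 'C(n, p)%:R * (ffactr x (n.+1 - p) * ffactr y p).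
    by rewrite [RHS]big_ord_recr /= bin_small// mul0r addr0.
  rewrite !(big_ord_recl n.+1) -addrA; congr (_ + _); first by rewrite !bin0.
  rewrite -big_split; apply: eq_bigr => p _ /=; rewrite /bump /= !add1n.
  by rewrite binS subSS natrD mulrDl.
rewrite E1 -big_split; apply: eq_bigr => p _ /=.
have pn : (p <= n)%N by rewrite -ltnS ltn_ord.
(* After Pascal's rule, the factor x + y - n is distributed as (x - (n - p)) + (y - p). *)
rewrite subSn// !ffactrS natrB//; ring.
Qed.

(* With the sums exchanged, the sum over m is a Vandermonde convolution at
   n - j - 1 and the remaining sum over i expands (1 + 3)^n. *)
Lemma laguerre_moment_identity nu n j :
  \sum_(m < n.+1) (-1) ^+ m * (ffactr (n%:R + nu) (n - m) / ((n - m)`!%:R * m`!%:R)) *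
    (\sum_(i < m.+1) 'C(m, i)%:R * 'C(j, i)%:R * i`!%:R * 3 ^+ i *
       ((-1) ^+ (m - i) * ffactr (- (j%:R + nu + 1)) (m - i))) =
  (- 4) ^+ n * 'C(j, n)%:R.
Proof.
pose f (m i : nat) := (-1) ^+ m * (ffactr (n%:R + nu) (n - m) / ((n - m)`!%:R * m`!%:R)) *
  ('C(m, i)%:R * 'C(j, i)%:R * i`!%:R * 3 ^+ i *
       ((-1) ^+ (m - i) * ffactr (- (j%:R + nu + 1)) (m - i))).
have f0 m i : (m < i)%N -> f m i = 0.
  by move=> mi; rewrite /f bin_small// !mul0r mulr0.
transitivity (\sum_(m < n.+1) \sum_(i < n.+1) f m i).
  apply: eq_bigr => m _; rewrite mulr_sumr.
  rewrite (big_ord_widen n.+1 (fun i => f m i)) ?ltn_ord// big_mkcond.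
  by apply: eq_bigr => i _; case: ifPn => //; rewrite -leqNgt => /f0 ->.
rewrite exchange_big /=.
have inner i : (i <= n)%N -> \sum_(m < n.+1) f m i =
    (-1) ^+ n * (3 ^+ i * ('C(j, i) * 'C(j - i, n - i))%:R).
  move=> i_n; rewrite -(big_mkord xpredT (fun m => f m i)).
  rewrite (@big_cat_nat _ _ _ i 0 n.+1) //=; last exact: leqW.
  rewrite big_nat_cond big1 ?add0r; last first.
    by move=> m /andP[/andP[_ mi] _]; exact: f0.
  rewrite -{1}(add0n i) big_addn subSn// big_mkord.
  (* For i > j every summand contains 'C(j, i) = 0, so j - i may be taken as a true difference
     afterwards. *)
  have [ji|ij] := ltnP j i.
    rewrite bin_small// mul0n !mulr0 big1// => p _.
    by rewrite /f [in 'C(j, i)]bin_small// !(mulr0, mul0r).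
  have -> : \sum_(p < (n - i).+1) f (p + i)%N i = (-1) ^+ i * 'C(j, i)%:R * 3 ^+ i / (n - i)`!%:R *
     \sum_(p < (n - i).+1) 'C(n - i, p)%:R * (ffactr (n%:R + nu) (n - i - p) *
        ffactr (- (j%:R + nu + 1)) p).
    rewrite mulr_sumr; apply: eq_bigr => p _.
    have pn : (p <= n - i)%N by rewrite -ltnS ltn_ord.
    rewrite /f addnK [(n - (p + i))%N]subnDA subnAC.
    have Fp : (p`!%:R : R) != 0 by rewrite pnatr_eq0 -lt0n fact_gt0.
    have Fi : (i`!%:R : R) != 0 by rewrite pnatr_eq0 -lt0n fact_gt0.
    have Fnp : ((n - i - p)`!%:R : R) != 0 by rewrite pnatr_eq0 -lt0n fact_gt0.
    have Fn : ((n - i)`!%:R : R) != 0 by rewrite pnatr_eq0 -lt0n fact_gt0.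
    have Fpi : ((p + i)`!%:R : R) != 0 by rewrite pnatr_eq0 -lt0n fact_gt0.
    have b1 : 'C(p + i, i)%:R * (i`!%:R * p`!%:R) = (p + i)`!%:R :> R.
      by have := @bin_fact (p + i) i (leq_addl _ _); rewrite addnK => <-; rewrite !natrM.
    have b2 : 'C(n - i, p)%:R * (p`!%:R * (n - i - p)`!%:R) = (n - i)`!%:R :> R.
      by rewrite -!natrM bin_fact.
    have {}b1 : 'C(p + i, i)%:R = (p + i)`!%:R / (i`!%:R * p`!%:R) :> R.
      by rewrite -b1 mulfK// mulf_neq0.
    have {}b2 : 'C(n - i, p)%:R = (n - i)`!%:R / (p`!%:R * (n - i - p)`!%:R) :> R.
      by rewrite -b2 mulfK// mulf_neq0.
    have aux (sp si A N P I Q CJ T B NI : R) : sp * sp = 1 -> N != 0 -> P != 0 -> I != 0 ->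
        Q != 0 -> NI != 0 -> sp * si * (A / (N * P)) * (P / (I * Q) * CJ * I * T * (sp * B)) =
        si * CJ * T / NI * (NI / (Q * N) * (A * B)).
      move=> s1 N0 P0 I0 Q0 NI0; rewrite -[RHS]mul1r -s1; field.
      by rewrite N0 P0 I0 Q0 NI0.
    by rewrite b1 b2 exprD; apply: aux => //; rewrite -expr2 sqrr_sign.
  rewrite ffactr_Vandermonde.
  (* Here nu cancels. Reflection then turns the argument into the natural number j - i, and the
     falling factorial into a binomial coefficient. *)
  rewrite (_ : n%:R + nu + - (j%:R + nu + 1) = n%:R - j%:R - 1 :> R); last by ring.
  rewrite ffactr_reflect natrB//.
  rewrite (_ : n%:R - i%:R - 1 - (n%:R - j%:R - 1) = (j - i)%:R :> R); last first.
    by rewrite natrB//; ring.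
  rewrite ffactr_nat -bin_ffact !natrM.
  have Fn : ((n - i)`!%:R : R) != 0 by rewrite pnatr_eq0 -lt0n fact_gt0.
  have -> : (-1) ^+ n = (-1) ^+ (n - i) * (-1) ^+ i :> R by rewrite -exprD subnK.
  set a := (-1) ^+ (n - i); set b := (-1) ^+ i; by field.
rewrite (eq_bigr (fun i : 'I_n.+1 => (-1) ^+ n * (3 ^+ i * ('C(j, i) * 'C(j - i, n - i))%:R))); last first.
  by move=> i _; apply: inner; rewrite -ltnS ltn_ord.
rewrite -mulr_sumr (_ : - 4 = -1 * 4 :> R) ?exprMn -?mulrA; last by ring.
congr (_ * _).
rewrite (_ : 4 = 1 + 3 :> R); last by ring.
rewrite exprDn mulr_suml; apply: eq_bigr => i _.
have i_n : (i <= n)%N by rewrite -ltnS ltn_ord.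
rewrite expr1n mul1r -[X in _ = X * _]mulr_natr -mulrA; congr (_ * _).
rewrite -natrM; congr _%:R.
(* Trinomial revision: multiplied by i! (n - i)! (j - n)!, both sides become j!. *)
have [nj|jn] := leqP n j.
  have ij : (i <= j)%N := leq_trans i_n nj.
  have nij : (n - i <= j - i)%N by rewrite leq_sub2r.
  have sE : (j - i - (n - i) = j - n)%N by rewrite subnBA// subnK.
  have k0 : (0 < i`! * ((n - i)`! * (j - n)`!))%N by rewrite !muln_gt0 !fact_gt0.
  apply/eqP; rewrite -(eqn_pmul2r k0); apply/eqP.
  transitivity (j`!).
    by rewrite mulnACA -sE (bin_fact nij) -mulnA (bin_fact ij).
  rewrite -(bin_fact nj) -(bin_fact i_n); ring.
rewrite [in RHS](bin_small jn) muln0.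
have [ij|ji] := leqP i j; last by rewrite bin_small.
by rewrite (bin_small (ltn_sub2r (leq_ltn_trans ij jn) jn)) muln0.
Qed.

End FallingFactorial.

Section GammaRatio.
Variable R : realType.
Implicit Types x y nu : R.

(** The rising factorial of [y] is written as a falling one at [- y], the form to which the
    Vandermonde convolution applies. *)
Lemma GammaDn y k : 0 < y -> Gamma (y + k%:R) = (-1) ^+ k * ffactr (- y) k * Gamma y.
Proof.
move=> y0; elim: k => [|k IH]; first by rewrite addr0 ffactr0 !mul1r.
have yk : 0 < y + k%:R by rewrite ltr_wpDr.
rewrite -natr1 addrA (GammaS yk) IH ffactrS exprS; ring.
Qed.

Lemma Gamma_ffactr nu n m : -1 < nu -> (m <= n)%N ->
  Gamma (n%:R + nu + 1) = ffactr (n%:R + nu) (n - m) * Gamma (m%:R + nu + 1).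
Proof.
move=> nu1 mn; rewrite -{1 2}(subnK mn); elim: (n - m)%N => [|k IH].
  by rewrite ffactr0 mul1r.
have p0 : 0 < (k + m)%:R + nu + 1 by have := ler0n R (k + m); lra.
rewrite addSn -natr1 (_ : (k + m)%:R + 1 + nu = (k + m)%:R + nu + 1); last by ring.
by rewrite (GammaS p0) IH ffactrSl mulrA.
Qed.

End GammaRatio.

(** * Complex power series *)

Section ComplexSeries.
Variable R : realType.
Implicit Types (z w s : R[i]) (u : nat -> R[i]) (v : nat -> R).

Lemma cvg_complex u (l : R[i]) :
  (fun n => Re (u n)) @ \oo --> Re l -> (fun n => Im (u n)) @ \oo --> Im l ->
  ((u : nat -> R[i]^o) @ \oo --> (l : R[i]^o)).
Proof.
move=> /cvgrPdist_lt uRe /cvgrPdist_lt uIm; apply/cvgrPdist_lt => e e0.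
(* The tolerance ranges over [R[i]], where being positive forces it to be real. *)
have [e1 eE] : exists e1 : R, e = e1%:C.
  by exists (Re e); rewrite RRe_real// gtr0_real.
rewrite eE ltcR in e0; have e2 : 0 < e1 / 2 by rewrite divr_gt0.
near=> n; have h1 : `|Re l - Re (u n)| < e1 / 2 by near: n; exact: uRe.
have h2 : `|Im l - Im (u n)| < e1 / 2 by near: n; exact: uIm.
rewrite eE -[X in X < _]/((normc (l - u n))%:C) ltcR.
by rewrite (le_lt_trans (normc_le_ReIm _))// ReDc ReNc ImDc ImNc [e1]splitr ltrD.
Unshelve. all: by end_near. Qed.

Lemma Re_series u n : Re (series (u : nat -> R[i]^o) n) = series (fun k => Re (u k)) n.
Proof. by rewrite /series /= Re_sum. Qed.
Lemma Im_series u n : Im (series (u : nat -> R[i]^o) n) = series (fun k => Im (u k)) n.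
Proof. by rewrite /series /= Im_sum. Qed.

Lemma cseries_cvg u v : (forall k, normc (u k) <= v k) -> cvgn (series v) ->
  (series (fun k => Re (u k)) @ \oo --> Re (cseries u)) /\
  (series (fun k => Im (u k)) @ \oo --> Im (cseries u)).
Proof.
move=> uv cv.
have cP (P : R[i] -> R) : (forall z, `|P z| <= normc z) -> cvgn (series (fun k => P (u k))).
  move=> hP; apply: normed_cvg; apply: (series_le_cvg _ _ _ cv) => k /=.
  - exact: normr_ge0.
  - exact: le_trans (normc_ge0 _) (uv k).
  - exact: le_trans (hP _) (uv k).
have cR := cP _ (@le_Re_normc R); have cI := cP _ (@le_Im_normc R).
suff -> : cseries u = limn (series (fun k => Re (u k))) +i* limn (series (fun k => Im (u k))).
  by [].
rewrite /cseries; apply: (@cvg_lim R[i]^o); first exact: norm_hausdorff.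
apply: cvg_complex.
  by under eq_fun do rewrite Re_series; exact: cR.
by under eq_fun do rewrite Im_series; exact: cI.
Qed.

End ComplexSeries.

Section ComplexExponential.
Variable R : realType.
Variable z : R[i].
Implicit Types (w : R[i]) (t : R).

(** Coefficients of the real power series t |-> Re (w e^(t z)). Multiplying [w] by [z]
    differentiates it, and w = 1, w = - i give the real and imaginary parts. *)
Let p w : nat -> R := fun n => Re (w * z ^+ n) / n`!%:R.

Let cvg_p w t : cvgn (pseries (p w) t).
Proof.
apply: normed_cvg.
apply: (series_le_cvg (v_ := fun n => normc w * exp_coeff (normc z * `|t|) n)) => [n|n|n|].
- exact: normr_ge0.
- by rewrite mulr_ge0 ?normc_ge0// exp_coeff_ge0// mulr_ge0 ?normc_ge0.
- rewrite /p /exp_coeff /= !normrM normfV normrX [`|n`!%:R|]ger0_norm//.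
  rewrite exprMn mulrAC !mulrA ler_wpM2r ?invr_ge0// ler_wpM2r ?exprn_ge0//.
  by rewrite (le_trans (le_Re_normc _))// normcM normcX.
- by apply: is_cvg_seriesZ; exact: is_cvg_series_exp_coeff.
Qed.

Let P w t : R := limn (pseries (p w) t).

Let diffs_p w : pseries_diffs (p w) = p (w * z).
Proof.
apply/funext => n; rewrite /pseries_diffs /p factS natrM exprS !mulrA.
by rewrite -mulf_div divff ?mul1r// pnatr_eq0.
Qed.

Let derive_P w t : is_derive t (1 : R) (P w) (P (w * z) t).
Proof.
have := @pseries_snd_diffs R (p w) (`|t| + 1) t; rewrite !diffs_p.
apply; try exact: cvg_p.
by rewrite [ltRHS]ger0_norm ?addr_ge0// ltrDl.
Qed.

Let x := Re z.
Let y := Im z.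

Let P0 w : P w 0 = Re w.
Proof.
apply: cvg_lim => //; rewrite -cvg_shiftS; apply: cvg_near_cst; apply: nearW => n.
rewrite /pseries /series /= big_nat_recl// !expr0 mulr1 /p fact0 divr1 expr0 mulr1.
by rewrite big1 ?addr0// => i _; rewrite expr0n mulr0.
Qed.

Let PD w1 w2 t (a b : R) : P (a%:C * w1 + b%:C * w2) t = a * P w1 t + b * P w2 t.
Proof.
apply: cvg_lim => //.
have h w : pseries (p w) t @ \oo --> P w t by exact: cvg_p.
have -> : pseries (p (a%:C * w1 + b%:C * w2)) t =
    fun n => a * pseries (p w1) t n + b * pseries (p w2) t n.
  apply/funext => n; rewrite /pseries /series /= !mulr_sumr -big_split.
  by apply: eq_bigr => i _ /=; rewrite /p mulrDl -!mulrA ReDc !ReCM; ring.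
by apply: cvgD; apply: cvgM; first [exact: cvg_cst|exact: h].
Qed.

Lemma exp_series_cvg :
  (series (fun n => Re (z ^+ n / n`!%:R)) @ \oo --> Re (cexp z)) /\
  (series (fun n => Im (z ^+ n / n`!%:R)) @ \oo --> Im (cexp z)).
Proof.
pose A := P 1; pose B := P (- 'i).
have dA t : is_derive t (1 : R) A (x * A t - y * B t).
  have := derive_P 1 t; rewrite (_ : 1 * z = x%:C * 1 + (- y)%:C * - 'i).
    by rewrite PD mulNr.
  by rewrite /x /y; case: (z) => a b; apply: eq_ReIm; rewrite /=; ring.
have dB t : is_derive t (1 : R) B (x * B t + y * A t).
  have := derive_P (- 'i) t; rewrite (_ : - 'i * z = x%:C * - 'i + y%:C * 1).
    by rewrite PD.
  by rewrite /x /y; case: (z) => a b; apply: eq_ReIm; rewrite /=; ring.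
(* A + i B solves Y' = z Y, and g + i h is e^(- t z) Y, hence constant and equal to its value 1 at t
   = 0. *)
pose g t := expR (- x * t) * (cos (y * t) * A t + sin (y * t) * B t).
pose h t := expR (- x * t) * (cos (y * t) * B t - sin (y * t) * A t).
have dg t : is_derive t (1 : R) g 0.
  rewrite /g; apply: is_derive_eq; rewrite /GRing.scale /= !(mulr0, mulr1, addr0, add0r).
  ring.
have dh t : is_derive t (1 : R) h 0.
  rewrite /h; apply: is_derive_eq; rewrite /GRing.scale /= !(mulr0, mulr1, addr0, add0r).
  ring.
have g1 : g 1 = 1.
  have -> : g 1 = g 0 by apply: is_derive_0_is_cst.
  rewrite /g !mulr0 expR0 cos0 sin0 /A P0 /=; ring.
have h1 : h 1 = 0.
  have -> : h 1 = h 0 by apply: is_derive_0_is_cst.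
  rewrite /h !mulr0 expR0 cos0 sin0 /A /B !P0 /=; ring.
have cs := cos2Dsin2 y.
have A1 : A 1 = expR x * cos y.
  have -> : A 1 = expR x * (cos y * g 1 - sin y * h 1).
    rewrite /g /h !mulr1 expRN.
    rewrite -[LHS]mul1r -cs; field; by rewrite gt_eqF // expR_gt0.
  by rewrite g1 h1; ring.
have B1 : B 1 = expR x * sin y.
  have -> : B 1 = expR x * (sin y * g 1 + cos y * h 1).
    rewrite /g /h !mulr1 expRN.
    rewrite -[LHS]mul1r -cs; field; by rewrite gt_eqF // expR_gt0.
  by rewrite g1 h1; ring.
have e n : z ^+ n / n`!%:R = (n`!%:R^-1)%:C * z ^+ n.
  by rewrite mulrC fmorphV rmorph_nat.
split.
  rewrite ReCM /= -A1 (_ : series _ = pseries (p 1) 1); first exact: cvg_p.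
  apply/funext => n; rewrite /pseries /series /=; apply: eq_bigr => i _.
  by rewrite e ReCM /p mul1r expr1n mulr1 mulrC.
rewrite ImCM /= -B1 (_ : series _ = pseries (p (- 'i)) 1); first exact: cvg_p.
apply/funext => n; rewrite /pseries /series /=; apply: eq_bigr => i _.
rewrite e ImCM /p expr1n mulr1 mulrC; congr (_ * _).
by case: (z ^+ i) => a b /=; ring.
Qed.

End ComplexExponential.

(** * Principal powers *)

Section Polar.
Variable R : realType.
Implicit Types (z w u : R[i]) (a r t nu : R).

Definition cis t : R[i] := cos t +i* sin t.

Lemma cisD s t : cis (s + t) = cis s * cis t.
Proof. by apply: eq_ReIm; rewrite /= ?cosD ?sinD //; ring. Qed.

Lemma cis0 : cis 0 = 1. Proof. by rewrite /cis cos0 sin0. Qed.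

Lemma conjcM z w : conjc (z * w) = conjc z * conjc w.
Proof. by case: z w => a b [c d]; apply: eq_ReIm; rewrite /=; ring. Qed.

Lemma conj_cis t : conjc (cis t) = cis (- t).
Proof. by rewrite /cis cosN sinN. Qed.

Lemma normc_cis t : normc (cis t) = 1.
Proof. by rewrite /= cos2Dsin2 sqrtr1. Qed.

Lemma cpowE z a : cpow z a = (normc z `^ a)%:C * cis (a * carg z).
Proof. by []. Qed.

Lemma normc_gt0 z : z != 0 -> 0 < normc z.
Proof. by move=> z0; rewrite lt0r normc_ge0 andbT; apply: contra z0 => /eqP/eq0_normc ->. Qed.

Lemma cargK z : z != 0 -> z = (normc z)%:C * cis (carg z).
Proof.
move=> z0; have r0 := normc_gt0 z0; set r := normc z in r0 *.
have rE : (Re z) ^+ 2 + (Im z) ^+ 2 = r ^+ 2.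
  by rewrite /r; case: (z) => x y /=; rewrite sqr_sqrtr// addr_ge0 ?sqr_ge0.
have xr : -1 <= Re z / r <= 1.
  by rewrite -ler_norml normrM normfV (ger0_norm (ltW r0)) ler_pdivrMr// mul1r le_Re_normc.
have sE : Num.sqrt (1 - (Re z / r) ^+ 2) = `|Im z| / r.
  rewrite (_ : 1 - _ = (`|Im z| / r) ^+ 2).
    by rewrite sqrtr_sqr ger0_norm// divr_ge0// ltW.
  rewrite [RHS]exprMn real_normK ?num_real//.
  have -> : Im z ^+ 2 = r ^+ 2 - Re z ^+ 2 by rewrite -rE addrC addKr.
  by field; rewrite gt_eqF.
apply: eq_ReIm; rewrite ?ReCM ?ImCM /= /carg -/r; case: ifPn => y0.
- by rewrite acosK// mulrCA divff ?mulr1// gt_eqF.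
- by rewrite cosN acosK// mulrCA divff ?mulr1// gt_eqF.
- by rewrite sin_acos// sE ger0_norm// mulrCA divff ?mulr1// gt_eqF.
- rewrite sinN sin_acos// sE ltr0_norm ?ltNge//.
  by rewrite mulNr opprK mulrCA divff ?mulr1// gt_eqF.
Qed.

Lemma carg_bounds z : z != 0 -> - pi < carg z <= pi.
Proof.
move=> z0; have r0 := normc_gt0 z0.
have xr : -1 <= Re z / normc z <= 1.
  by rewrite -ler_norml normrM normfV (ger0_norm (ltW r0)) ler_pdivrMr// mul1r le_Re_normc.
have a0 := acos_ge0 xr; have api := acos_lepi xr; have p0 := pi_gt0 R.
rewrite /carg; case: ifPn => y0.
  by rewrite api andbT (lt_le_trans _ a0)// oppr_lt0.
rewrite (le_trans _ (ltW p0)) ?oppr_le0// andbT ltrN2.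
rewrite lt_neqAle api andbT; apply: contra y0 => /eqP ae.
have h : Re z / normc z = -1 by rewrite -(acosK xr) ae cospi.
have xE : Re z = - normc z by rewrite -[LHS](divfK (lt0r_neq0 r0)) h mulN1r.
have rE : (Re z) ^+ 2 + (Im z) ^+ 2 = normc z ^+ 2.
  by case: (z) => x y /=; rewrite sqr_sqrtr// addr_ge0 ?sqr_ge0.
have /eqP : Im z ^+ 2 = 0 by move: rE; rewrite xE sqrrN; lra.
by rewrite sqrf_eq0 => /eqP ->.
Qed.

Lemma carg_unique r t : 0 < r -> - pi < t <= pi -> carg (r%:C * cis t) = t.
Proof.
move=> r0 /andP[t1 t2].
have nE : normc (r%:C * cis t) = r by rewrite normcM normcR normc_cis mulr1 gtr0_norm.
rewrite /carg nE ReCM ImCM /= mulrAC divff ?gt_eqF// mul1r pmulr_rge0//.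
have [t0|t0] := leP 0 t.
  have st : 0 <= sin t by apply: sin_ge0_pi; rewrite t0.
  by rewrite st cosK// in_itv /= t0.
have sn : sin t < 0 by rewrite -oppr_gt0 -sinN sin_gt0_pi// oppr_gt0 t0 ltrNl.
by rewrite leNgt sn /= -cosN cosK ?opprK// in_itv /= oppr_ge0 (ltW t0) lerNl ltW.
Qed.

(** Half-angle formulas: in this range cos (t / 2) >= 0, and off the real axis sin (t / 2) has the
    sign of sin t. *)
Lemma sqrtc_polar r t : 0 < r -> - pi < t <= pi ->
  sqrtc (r%:C * cis t) = (Num.sqrt r)%:C * cis (t / 2).
Proof.
move=> r0 /andP[t1 t2].
have c2 : cos t = cos (t / 2) ^+ 2 - sin (t / 2) ^+ 2.
  by rewrite {1}(splitr t) cosD !expr2.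
have cs := cos2Dsin2 (t / 2).
have -> : r%:C * cis t = (r * cos t) +i* (r * sin t).
  by apply: eq_ReIm; rewrite ?ReCM ?ImCM.
have nE : Num.sqrt ((r * cos t) ^+ 2 + (r * sin t) ^+ 2) = r.
  by rewrite !exprMn -mulrDr cos2Dsin2 mulr1 sqrtr_sqr gtr0_norm.
rewrite /sqrtc nE.
have -> : (r + r * cos t) / 2 = r * cos (t / 2) ^+ 2.
  transitivity ((r * (cos (t / 2) ^+ 2 + sin (t / 2) ^+ 2) + r * cos t) / 2).
    by rewrite cs mulr1.
  by rewrite c2; field.
have -> : (r - r * cos t) / 2 = r * sin (t / 2) ^+ 2.
  transitivity ((r * (cos (t / 2) ^+ 2 + sin (t / 2) ^+ 2) - r * cos t) / 2).
    by rewrite cs mulr1.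
  by rewrite c2; field.
rewrite (sqrtrM _ (ltW r0)) (sqrtrM _ (ltW r0)) !sqrtr_sqr.
have hc : 0 <= cos (t / 2).
  by apply: cos_ge0_pihalf; rewrite ler_pdivlMr// ler_pdivrMr//; apply/andP; split; lra.
apply: eq_ReIm; rewrite ?ReCM ?ImCM /=; first by rewrite ger0_norm.
rewrite mulrCA; congr (_ * _).
have [t0|t0] := leP 0 t.
  have s0 : 0 <= sin (t / 2).
    by apply: sin_ge0_pi; rewrite divr_ge0//= ler_pdivrMr//; have := pi_ge0 R; lra.
  have st0 : 0 <= sin t by rewrite sin_ge0_pi ?t0.
  (* On the real axis [sqrtc] uses the sign 1, which is right both at t = 0 and on the negative axis
     t = pi. *)
  rewrite (ger0_norm s0); case: eqP => [|/eqP h]; first by rewrite mul1r.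
  by rewrite gtr0_sg ?mul1r// lt0r h mulr_ge0// ltW.
have s0 : sin (t / 2) < 0.
  rewrite -oppr_gt0 -sinN; apply: sin_gt0_pi; apply/andP; split; first lra.
  by have := pi_gt0 R; lra.
have st0 : sin t < 0 by rewrite -oppr_gt0 -sinN sin_gt0_pi// oppr_gt0 t0 ltrNl.
have h : r * sin t < 0 by rewrite pmulr_rlt0.
by rewrite lt_eqF// ltr0_sg// (ltr0_norm s0) mulN1r opprK.
Qed.

Lemma carg_sqrtc z : z != 0 -> carg (sqrtc z) = carg z / 2.
Proof.
move=> z0; have r0 := normc_gt0 z0; have /andP[t1 t2] := carg_bounds z0.
have b : - pi < carg z / 2 <= pi by have p0 := pi_gt0 R; apply/andP; split; lra.
by rewrite {1}(cargK z0) sqrtc_polar ?carg_bounds// carg_unique// sqrtr_gt0.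
Qed.

Lemma normc_sqrtc z : normc (sqrtc z) = Num.sqrt (normc z).
Proof.
apply/eqP; rewrite -(@eqrXn2 _ 2)// ?normc_ge0 ?sqrtr_ge0//.
by rewrite -normcX sqr_sqrtc sqr_sqrtr// normc_ge0.
Qed.

Lemma cpow0 a : cpow 0 a = (a == 0)%:R :> R[i].
Proof.
rewrite cpowE normc0; case: eqVneq => [->|a0]; last by rewrite powR0// mul0r.
by rewrite powRr0 mul0r cis0 mulr1.
Qed.

Lemma sqrt_powR r a : 0 <= r -> Num.sqrt r `^ a = r `^ (a / 2).
Proof. by move=> r0; rewrite -powR12_sqrt// -powRrM mulrC. Qed.

(** The argument of the square root is half that of [u], so the two phases are opposite. *)
Lemma cpow_half_conj u nu : u != 0 ->
  cpow u (nu / 2) * conjc (cpow (sqrtc u) nu) = (normc u `^ nu)%:C.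
Proof.
move=> u0; have r0 := normc_gt0 u0.
rewrite !cpowE conjcM conj_cis carg_sqrtc// normc_sqrtc sqrt_powR ?normc_ge0//.
rewrite conjc_real mulrACA -rmorphM -powRD ?(gt_eqF r0) ?implybT// -splitr.
by rewrite -cisD (_ : nu / 2 * carg u + _ = 0) ?cis0 ?mulr1//; ring.
Qed.

Lemma cis_nat t n : cis t ^+ n = cis (n%:R * t).
Proof.
elim: n => [|n IH]; first by rewrite mul0r cis0.
by rewrite exprS IH -cisD -natr1; congr cis; ring.
Qed.

Lemma cpow_nat_half z n nu : -1 < nu ->
  cpow z (n%:R + nu / 2) = z ^+ n * cpow (sqrtc z) nu.
Proof.
move=> nu1; have [->|z0] := eqVneq z 0.
  (* At z = 0 the conventions 0^0 = 1 and 0^a = 0 make both sides agree, negative nu included. *)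
  rewrite sqrtc0 !cpow0; case: n => [|n].
    by rewrite add0r expr0 mul1r mulf_eq0 invr_eq0 pnatr_eq0 orbF.
  rewrite expr0n mul0r (_ : _ == 0 = false)//; apply/negbTE; rewrite gt_eqF//.
  by rewrite -natr1; have := ler0n R n; lra.
have r0 := normc_gt0 z0.
rewrite !cpowE {3}(cargK z0) exprMn cis_nat carg_sqrtc// normc_sqrtc sqrt_powR ?normc_ge0//.
have -> : normc z `^ (n%:R + nu / 2) = normc z ^+ n * normc z `^ (nu / 2).
  by rewrite powRD ?(gt_eqF r0) ?implybT// powR_mulrn ?normc_ge0.
rewrite rmorphM rmorphXn mulrDl cisD.
by rewrite (_ : nu * (carg z / 2) = nu / 2 * carg z); ring.
Qed.

(** Arguments of principal square roots lie in ]-pi/2, pi/2], so their difference stays in ]-pi, pi[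
    and the principal power is multiplicative here: the branch rule of the statement holds
    automatically. *)
Lemma cpow_scaled_sqrt_conj a nu z u : 0 < a ->
  cpow (a%:C * (sqrtc z * conjc (sqrtc u))) nu =
  cpow (sqrtc z) nu * ((a `^ nu)%:C * conjc (cpow (sqrtc u) nu)).
Proof.
move=> a0; have [->|z0] := eqVneq z 0.
  rewrite sqrtc0 mul0r mulr0 !cpow0; case: eqVneq => [->|]; last by rewrite !mul0r.
  by rewrite powRr0 !mul1r cpowE powRr0 mul0r cis0 mulr1 conjc1.
have [->|u0] := eqVneq u 0.
  rewrite sqrtc0 conjc0 !mulr0 !cpow0; case: eqVneq => [->|]; last first.
    by move=> _; rewrite conjc0 !mulr0.
  by rewrite powRr0 conjc1 !mulr1 cpowE powRr0 mul0r cis0 mulr1.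
have rz := normc_gt0 z0; have ru := normc_gt0 u0.
have /andP[z1 z2] := carg_bounds z0; have /andP[u1 u2] := carg_bounds u0.
pose rho := a * (Num.sqrt (normc z) * Num.sqrt (normc u)).
have rho0 : 0 < rho by rewrite !mulr_gt0 ?sqrtr_gt0.
have sz w : w != 0 -> sqrtc w = (Num.sqrt (normc w))%:C * cis (carg w / 2).
  by move=> w0; rewrite {1}(cargK w0) sqrtc_polar ?carg_bounds// normc_gt0.
have wE : a%:C * (sqrtc z * conjc (sqrtc u)) = rho%:C * cis (carg z / 2 - carg u / 2).
  rewrite (sz _ z0) (sz _ u0) conjcM conjc_real conj_cis cisD /rho.
  by rewrite !rmorphM; ring.
rewrite wE cpowE carg_unique//; last by apply/andP; split; lra.
rewrite normcM normcR normc_cis mulr1 gtr0_norm// !cpowE !carg_sqrtc// !normc_sqrtc.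
rewrite conjcM conjc_real conj_cis /rho.
rewrite powRM ?(ltW a0) ?mulr_ge0 ?sqrtr_ge0// powRM ?sqrtr_ge0// !rmorphM.
by rewrite mulrBr cisD; ring.
Qed.

End Polar.

(** * Integration of the Bessel series *)

Section BesselSeries.
Variable R : realType.
Implicit Types (nu x y : R) (s : R[i]).

Definition bessel_coeff nu k : R := (k`!%:R * Gamma (k%:R + nu + 1))^-1.

Lemma bessel_index_gt0 nu k : -1 < nu -> 0 < k%:R + nu + 1.
Proof. by move=> nu1; have := ler0n R k; lra. Qed.

(** Induction on [k], since k + nu + 1 >= kap (k + 1); the minimum covers nu < 0. *)
Lemma Gamma_lower nu k : -1 < nu ->
  Gamma (nu + 1) * Num.min 1 (nu + 1) ^+ k * k`!%:R <= Gamma (k%:R + nu + 1).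
Proof.
move=> nu1; set kap := Num.min _ _.
have nu0 : 0 < nu + 1 by rewrite -ltrBlDr sub0r.
have k0 : 0 < kap by rewrite lt_min ltr01.
have k1 : kap <= 1 by rewrite ge_min lexx.
have k2 : kap <= nu + 1 by rewrite ge_min lexx orbT.
have G0 := Gamma_gt0 nu0.
elim: k => [|k IH]; first by rewrite expr0 fact0 !mulr1 add0r.
have p0 := bessel_index_gt0 k nu1.
have -> : k.+1%:R + nu + 1 = k%:R + nu + 1 + 1 by rewrite -natr1; ring.
rewrite (GammaS p0).
have -> : Gamma (nu + 1) * kap ^+ k.+1 * k.+1`!%:R =
  kap * k.+1%:R * (Gamma (nu + 1) * kap ^+ k * k`!%:R).
  by rewrite exprS factS natrM; ring.
apply: ler_pM IH.
- by rewrite (mulr_ge0 (ltW k0))// ler0n.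
- by rewrite (mulr_ge0 (mulr_ge0 (ltW G0) (exprn_ge0 _ (ltW k0))))// ler0n.
have h : kap * k%:R <= 1 * k%:R by rewrite (ler_wpM2r (ler0n R k) k1).
by rewrite -natr1 mulrDr mulr1 -addrA (lerD _ k2)// -[leRHS]mul1r.
Qed.

Lemma bessel_coeff_ge0 nu k : -1 < nu -> 0 <= bessel_coeff nu k.
Proof.
move=> nu1; rewrite /bessel_coeff invr_ge0 mulr_ge0// ltW// Gamma_gt0//; exact: bessel_index_gt0.
Qed.

(** The coefficient decays like 1 / (k!)^2. One factorial absorbs x^k into e^x, the other makes y^k
    an exponential term. With |u| placed in [y] and |z| in [x], the growth rate in |u| can be chosen
    freely. *)
Lemma bessel_coeff_le nu k x y : -1 < nu -> 0 <= x -> 0 <= y ->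
  bessel_coeff nu k * (Num.min 1 (nu + 1) * x * y) ^+ k <=
  (Gamma (nu + 1))^-1 * expR x * exp_coeff y k.
Proof.
move=> nu1 x0 y0; have nu0 : 0 < nu + 1 by rewrite -ltrBlDr sub0r.
have k0 : 0 < Num.min 1 (nu + 1) by rewrite lt_min ltr01.
have hG := Gamma_lower k nu1; have G0 := Gamma_gt0 nu0.
have Gk := Gamma_gt0 (bessel_index_gt0 k nu1).
have f0 : (0 : R) < k`!%:R by rewrite ltr0n fact_gt0.
have hx := expr_le_fact_expR k x0.
rewrite /bessel_coeff /exp_coeff /= !exprMn.
move: (Num.min _ _) (Gamma (nu + 1)) (Gamma (k%:R + nu + 1)) k0 G0 Gk hG => kap G H k0 G0 H0 hG.
move: (exprn_ge0 k (ltW k0)) (exprn_ge0 k y0) hG hx.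
move: (kap ^+ k) (x ^+ k) (y ^+ k) (k`!%:R : R) (expR x) (expR_ge0 x) f0.
move=> A B C f E E0 f0 A0 C0 hG hx.
rewrite mulrC ler_pdivrMr ?mulr_gt0//.
apply: (@le_trans _ _ (A * (f * E) * C)).
  by rewrite (ler_wpM2r C0)// (ler_wpM2l A0).
have -> : G^-1 * E * (C / f) * (f * H) = (E * C / G) * H.
  by field; rewrite !gt_eqF.
have -> : A * (f * E) * C = (E * C / G) * (G * A * f).
  by field; rewrite gt_eqF.
by rewrite ler_wpM2l// divr_ge0 ?(ltW G0)// mulr_ge0.
Qed.

Lemma series_exp_coeff_le y N : 0 <= y -> series (exp_coeff y) N <= expR y.
Proof.
move=> y0; apply: nondecreasing_cvgn_le; last exact: is_cvg_series_exp_coeff.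
by apply: nondecreasing_series => k _ _; exact: exp_coeff_ge0.
Qed.

Lemma besselI_entire_cvg nu s : -1 < nu ->
  let u k := (bessel_coeff nu k)%:C * s ^+ k in
  (series (fun k => Re (u k)) @ \oo --> Re (besselI_entire nu s)) /\
  (series (fun k => Im (u k)) @ \oo --> Im (besselI_entire nu s)).
Proof.
move=> nu1 u; have nu0 : 0 < nu + 1 by rewrite -ltrBlDr sub0r.
set kap := Num.min 1 (nu + 1).
have k0 : 0 < kap by rewrite lt_min ltr01.
pose y := normc s / kap.
have y0 : 0 <= y by rewrite divr_ge0 ?normc_ge0// ltW.
apply: (@cseries_cvg _ u
  (fun k => (Gamma (nu + 1))^-1 * expR 1 * exp_coeff y k)) => [k|].
  rewrite normcM normcR ger0_norm ?bessel_coeff_ge0// normcX.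
  have := bessel_coeff_le k nu1 ler01 y0.
  by rewrite -/kap mulr1 mulrCA divff ?mulr1// gt_eqF.
exact: is_cvg_seriesZ (is_cvg_series_exp_coeff y).
Qed.

Lemma bessel_partial_le nu s x y N : -1 < nu -> 0 <= x -> 0 <= y ->
  normc s = Num.min 1 (nu + 1) * x * y ->
  normc (\sum_(k < N) (bessel_coeff nu k)%:C * s ^+ k) <=
  (Gamma (nu + 1))^-1 * expR x * expR y.
Proof.
move=> nu1 x0 y0 sE; have nu0 : 0 < nu + 1 by rewrite -ltrBlDr sub0r.
have G0 := Gamma_gt0 nu0.
apply: (le_trans (le_normc_sum _ _ _)).
apply: (@le_trans _ _ (\sum_(k < N) (Gamma (nu + 1))^-1 * expR x * exp_coeff y k)).
  apply: ler_sum => k _; rewrite normcM normcR ger0_norm ?bessel_coeff_ge0// normcX sE.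
  exact: bessel_coeff_le.
rewrite -mulr_sumr; apply: ler_wpM2l.
  by rewrite mulr_ge0 ?expR_ge0// invr_ge0 ltW.
by have := series_exp_coeff_le N y0; rewrite /series /= big_mkord.
Qed.

End BesselSeries.

Section ComplexConvergence.
Variable R : realType.
Implicit Types (u : nat -> R[i]) (l : R[i]).

Definition ccvg u l : Prop :=
  (fun k => Re (u k)) @ \oo --> Re l /\ (fun k => Im (u k)) @ \oo --> Im l.

Lemma ccvgMl (a : R[i]) u l : ccvg u l -> ccvg (fun k => a * u k) (a * l).
Proof.
move=> [ur ui]; split.
  rewrite ReMc (_ : (fun _ => _) = fun k => Re a * Re (u k) - Im a * Im (u k)).
    by apply: cvgB; apply: cvgMr.
  by apply/funext => k; rewrite ReMc.
rewrite ImMc (_ : (fun _ => _) = fun k => Re a * Im (u k) + Im a * Re (u k)).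
  by apply: cvgD; apply: cvgMr.
by apply/funext => k; rewrite ImMc.
Qed.

Lemma ccvg_unique u l l' : ccvg u l -> ccvg u l' -> l = l'.
Proof.
move=> [r1 i1] [r2 i2]; apply: eq_ReIm.
  by apply: cvg_unique r1 r2.
by apply: cvg_unique i1 i2.
Qed.

End ComplexConvergence.

Section LaguerreMoments.
Variable R : realType.
Local Notation mu := (@lebesgue_measure R).
Local Notation mu2 := (sfprod mu mu).
Variables (alpha nu : R) (n : nat).
Hypotheses (alpha_gt0 : 0 < alpha) (nu_gtN1 : -1 < nu).
Implicit Types (u : R * R) (z : R[i]).

Definition scaled_laguerre_coeff m : R :=
  (-1) ^+ m * Gamma (n%:R + nu + 1)
     / ((n - m)`!%:R * Gamma (m%:R + nu + 1) * m`!%:R) * (- (alpha / 4)) ^+ m.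

Local Notation l := scaled_laguerre_coeff.

Definition planar_laguerre u : R[i] := laguerre nu n (- ((alpha / 4)%:C * cplx u)).

Lemma planar_laguerreE u :
  planar_laguerre u = \sum_(m < n.+1) (l m)%:C * cplx u ^+ m.
Proof.
apply: eq_bigr => m _; rewrite /l -mulNr exprMn mulrA -rmorphN -rmorphXn -rmorphM.
by [].
Qed.

(** The rate is half of alpha / 12; the Bessel partial sums receive the other half. *)
Lemma planar_laguerre_le : exists C : R, forall u,
  normc (planar_laguerre u) <= C * expR (alpha / 24 * normc (cplx u)).
Proof.
have d0 : 0 < alpha / 24 by rewrite divr_gt0.
exists (\sum_(m < n.+1) `|l m| * ((m + 0)`!%:R / (alpha / 24) ^+ (m + 0))) => u.
rewrite planar_laguerreE (le_trans (le_normc_sum _ _ _))// mulr_suml.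
apply: ler_sum => m _; rewrite normcM normcR.
have := normc_monomial_le m 0 d0 u; rewrite expr0 mulr1.
by move=> /(ler_wpM2l (normr_ge0 (l m))); rewrite mulrA.
Qed.

Lemma cmeasurable_planar_laguerre : cmeasurable planar_laguerre.
Proof.
rewrite (_ : planar_laguerre = fun u => \sum_(m < n.+1) (l m)%:C * cplx u ^+ m).
  apply: cmeasurable_sum => m; apply: cmeasurableM; first exact: cmeasurable_cst.
  by apply: cmeasurableX; exact: cmeasurable_cplx.
by apply/funext => u; exact: planar_laguerreE.
Qed.

(** pi * 36 / alpha^2 is the Gaussian mass pi / b without its e^t, and the power of 4 / 3 comes from
    the rate 3 / 4 of the gamma integral. *)
Definition moment_const : R := pi * (36 / alpha ^+ 2) * (4 / 3) `^ (nu + 1).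

Definition planar_moment_value m k : R :=
  let p i := nu + 1 + (m - i + (k - i) + i)%:R in
  \sum_(i < m.+1) 'C(m, i)%:R * 'C(k, i)%:R * i`!%:R * pi *
    (- (3 / alpha)) ^+ (m - i + (k - i)) * (36 / alpha ^+ 2) ^+ i.+1 *
    ((3 / 4) `^ (- p i) * Gamma (p i)).

(** Collecting powers with exponents m - i, k - i and i gives the bases 1, - 4 / alpha and 3 (- 4 /
    alpha). Hence [m] disappears, and the only trace of [i] is the 3^i of the Vandermonde
    identity. *)
Lemma planar_moment_term m k i : (i <= m)%N -> (i <= k)%N ->
  (- (alpha / 4)) ^+ m * ((- (3 / alpha)) ^+ (m - i + (k - i)) *
    (36 / alpha ^+ 2) ^+ i.+1 * (3 / 4) `^ (- (nu + 1 + (m - i + (k - i) + i)%:R))) =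
  36 / alpha ^+ 2 * (4 / 3) `^ (nu + 1) * (- (4 / alpha)) ^+ k * 3 ^+ i.
Proof.
move=> im ik; have a0 : alpha != 0 by rewrite gt_eqF.
set d := (m - i)%N; set e := (k - i)%N.
have -> : m = (d + i)%N by rewrite subnK.
have -> : k = (e + i)%N by rewrite subnK.
have -> : (3 / 4 : R) `^ (- (nu + 1 + (d + e + i)%:R)) =
    (4 / 3) `^ (nu + 1) * (4 / 3) ^+ (d + e + i).
  have q0 : 0 < (3 / 4 : R) `^ (nu + 1 + (d + e + i)%:R) by rewrite powR_gt0.
  rewrite powRN -powR_mulrn// -powRD; last by apply/implyP => _; rewrite gt_eqF.
  apply: (mulfI (lt0r_neq0 q0)); rewrite mulfV ?gt_eqF// -powRM//.
  by rewrite (_ : 3 / 4 * (4 / 3) = 1 :> R) ?powR1//; field.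
have h1 : (- (alpha / 4)) * - (3 / alpha) * (4 / 3) = 1 by field.
have h2 : - (3 / alpha) * (4 / 3) = - (4 / alpha) by field.
have h3 : - (alpha / 4) * (36 / alpha ^+ 2) * (4 / 3) = - (4 / alpha) * 3 by field.
transitivity (36 / alpha ^+ 2 * (4 / 3) `^ (nu + 1) *
  (((- (alpha / 4)) * - (3 / alpha) * (4 / 3)) ^+ d *
   (- (3 / alpha) * (4 / 3)) ^+ e *
   (- (alpha / 4) * (36 / alpha ^+ 2) * (4 / 3)) ^+ i)).
  move: (4 / 3) (3 / alpha) (alpha / 4) (36 / alpha ^+ 2) => A B D E.
  by rewrite !exprMn !exprD exprS; ring.
by rewrite h1 h2 h3 expr1n mul1r exprMn exprD; ring.
Qed.

Lemma laguerre_moment k :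
  \sum_(m < n.+1) l m * planar_moment_value m k =
  moment_const * (- (4 / alpha)) ^+ k * Gamma (k%:R + nu + 1) * ((- 4) ^+ n * 'C(k, n)%:R).
Proof.
rewrite -(laguerre_moment_identity nu n k) mulr_sumr; apply: eq_bigr => -[m /= mn] _.
have Gm : 0 < Gamma (m%:R + nu + 1) by exact: (Gamma_gt0 (bessel_index_gt0 m nu_gtN1)).
have p0 := bessel_index_gt0 k nu_gtN1.
have fm : m`!%:R != 0 :> R by rewrite pnatr_eq0 -lt0n fact_gt0.
have fnm : (n - m)`!%:R != 0 :> R by rewrite pnatr_eq0 -lt0n fact_gt0.
have lE : l m = (-1) ^+ m * (ffactr (n%:R + nu) (n - m) / ((n - m)`!%:R * m`!%:R)) *
    (- (alpha / 4)) ^+ m.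
  rewrite /l (@Gamma_ffactr _ nu n m nu_gtN1 mn); congr (_ * _).
  by field; rewrite fm fnm gt_eqF.
rewrite lE; set A0 := (-1) ^+ m * _.
rewrite -(mulrA A0) [RHS](mulrCA _ A0); congr (A0 * _).
rewrite /planar_moment_value !mulr_sumr; apply: eq_bigr => -[i /= im] _.
(* Past this point the truncated subtraction k - i is a true one. *)
have [ki|ik] := ltnP k i; first by rewrite (bin_small ki) !(mulr0, mul0r).
have -> : nu + 1 + (m - i + (k - i) + i)%:R = k%:R + nu + 1 + (m - i)%:R.
  by rewrite -addnA subnK// natrD; ring.
rewrite (GammaDn _ p0).
have := @planar_moment_term m k i im ik.
have -> : nu + 1 + (m - i + (k - i) + i)%:R = k%:R + nu + 1 + (m - i)%:R.
  by rewrite -addnA subnK// natrD; ring.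
rewrite /moment_const.
move: (_ `^ (- _)) (Gamma _) (ffactr _ _) ((- (alpha / 4)) ^+ m)
  ((- (3 / alpha)) ^+ _) (_ ^+ i.+1) ((-1) ^+ (m - i)) => A B D E F G H e.
transitivity ('C(m, i)%:R * 'C(k, i)%:R * i`!%:R * pi * (E * (F * G * A)) * (H * D * B)); first ring.
by rewrite e; ring.
Qed.

Lemma planar_monomial_integrable m k :
  cintegrable mu2 (fun u => planar_monomial m k u * (planar_weight alpha nu u)%:C).
Proof.
have d0 : 0 < alpha / 12 by rewrite divr_gt0.
have [i _] := cintegral_planar_weight alpha_gt0 nu_gtN1 (@cmeasurable_planar_monomial R m k)
  (normc_monomial_le m k d0).
exact: i.
Qed.

Variable z : R[i].

(** The value of w^2 / 4 at w = (alpha / 2) sqrt (z conj u). *)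
Definition bessel_arg u : R[i] := (alpha ^+ 2 / 16)%:C * (z * conjc (cplx u)).

Definition laguerre_bessel_partial N u : R[i] :=
  planar_laguerre u * \sum_(k < N) (bessel_coeff nu k)%:C * bessel_arg u ^+ k.

Lemma laguerre_bessel_partialE N u : laguerre_bessel_partial N u =
  \sum_(k < N) \sum_(m < n.+1)
    ((l m * (bessel_coeff nu k * (alpha ^+ 2 / 16) ^+ k))%:C * z ^+ k) * planar_monomial m k u.
Proof.
rewrite /laguerre_bessel_partial mulr_sumr; apply: eq_bigr => k _.
rewrite planar_laguerreE mulr_suml; apply: eq_bigr => m _.
rewrite /bessel_arg /planar_monomial.
move: (alpha ^+ 2 / 16) (l m) (bessel_coeff _ _) => A B C.
by rewrite !exprMn (rmorphM _ B) (rmorphM _ C) rmorphXn /=; ring.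
Qed.

Lemma cintegral_laguerre_bessel_partial N :
  cintegral mu2 (fun u => laguerre_bessel_partial N u * (planar_weight alpha nu u)%:C) =
  \sum_(k < N) (moment_const * (- 4) ^+ n * ('C(k, n)%:R / k`!%:R) *
    (- (alpha / 4)) ^+ k)%:C * z ^+ k.
Proof.
pose c m k : R[i] := (l m * (bessel_coeff nu k * (alpha ^+ 2 / 16) ^+ k))%:C * z ^+ k.
pose g m k u := planar_monomial m k u * (planar_weight alpha nu u)%:C.
have gi m k : cintegrable mu2 (g m k) by exact: planar_monomial_integrable.
have -> : (fun u => laguerre_bessel_partial N u * (planar_weight alpha nu u)%:C) =
   (fun u => \sum_(k < N) \sum_(m < n.+1) c m k * g m k u).
  apply/funext => u; rewrite laguerre_bessel_partialE mulr_suml; apply: eq_bigr => k _.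
  by rewrite mulr_suml; apply: eq_bigr => m _; rewrite -mulrA.
rewrite cintegral_sum; last by move=> k; apply: cintegrable_sum => m; exact: cintegrableZ.
apply: eq_bigr => k _.
rewrite cintegral_sum; last by move=> m; exact: cintegrableZ.
have a0 : alpha != 0 by rewrite gt_eqF.
have p0 := bessel_index_gt0 k nu_gtN1.
have Gk := Gamma_gt0 p0.
transitivity ((bessel_coeff nu k * (alpha ^+ 2 / 16) ^+ k * \sum_(m < n.+1) l m * planar_moment_value m k)%:C * z ^+ k).
  rewrite mulr_sumr rmorph_sum mulr_suml; apply: eq_bigr => m _.
  rewrite (cintegralZ _ (gi m k)) /c /g planar_moment// -/(planar_moment_value m k).
  by rewrite !rmorphM; ring.
congr (_%:C * _); rewrite laguerre_moment /bessel_coeff.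
have -> : (- (alpha / 4)) ^+ k = (alpha ^+ 2 / 16) ^+ k * (- (4 / alpha)) ^+ k :> R.
  by rewrite -exprMn; congr (_ ^+ _); field.
have fk : k`!%:R != 0 :> R by rewrite pnatr_eq0 -lt0n fact_gt0.
move: (_ ^+ k) ((- (4 / alpha)) ^+ k) ((-4) ^+ n) => A B D.
by field; rewrite fk gt_eqF.
Qed.

(** The index starts at n because 'C(k, n) = 0 below it. Then 'C(n + k, n) / (n + k)! = 1 / (n! k!)
    separates the variables, and (-4)^n (- alpha / 4)^n = alpha^n. *)
Lemma cintegral_laguerre_bessel_partialD N :
  cintegral mu2 (fun u => laguerre_bessel_partial (n + N) u * (planar_weight alpha nu u)%:C) =
  (moment_const * alpha ^+ n / n`!%:R)%:C * z ^+ n *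
    \sum_(k < N) (- ((alpha / 4)%:C * z)) ^+ k / k`!%:R.
Proof.
rewrite cintegral_laguerre_bessel_partial big_split_ord /= big1 ?add0r => [|k _]; last first.
  by rewrite bin_small// mul0r mulr0 mul0r mul0r.
rewrite mulr_sumr; apply: eq_bigr => k _.
have kf : 'C(n + k, n)%:R / (n + k)`!%:R = (n`!%:R * k`!%:R)^-1 :> R.
  have := bin_fact (leq_addr k n); rewrite addKn => /(congr1 (fun i => i%:R : R)).
  have f0 j : j`!%:R != 0 :> R by rewrite pnatr_eq0 -lt0n fact_gt0.
  have c0 : 'C(n + k, n)%:R != 0 :> R by rewrite pnatr_eq0 -lt0n bin_gt0 leq_addr.
  by rewrite !natrM => <-; field; rewrite c0 !f0.
have -> : (- ((alpha / 4)%:C * z)) ^+ k / k`!%:R = ((- (alpha / 4)) ^+ k / k`!%:R)%:C * z ^+ k.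
  by rewrite -mulNr exprMn -(rmorphN (real_complex R)) -rmorphXn rmorphM /= fmorphV rmorph_nat; ring.
rewrite [RHS]mulrACA -exprD -(rmorphM (real_complex R)); congr (_%:C * _); rewrite kf.
have -> : alpha ^+ n = (- 4) ^+ n * (- (alpha / 4)) ^+ n :> R.
  by rewrite -exprMn; congr (_ ^+ _); field.
by rewrite exprD invfM; ring.
Qed.

Definition laguerre_bessel u : R[i] := planar_laguerre u * besselI_entire nu (bessel_arg u).

Lemma laguerre_bessel_partial_cvg u : ccvg (laguerre_bessel_partial ^~ u) (laguerre_bessel u).
Proof.
apply: ccvgMl; have [hr hi] := besselI_entire_cvg (bessel_arg u) nu_gtN1.
split.
  rewrite (_ : (fun _ => _) =
    series (fun k => Re ((bessel_coeff nu k)%:C * bessel_arg u ^+ k)))//.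
  by apply/funext => k; rewrite Re_sum /series /= big_mkord.
rewrite (_ : (fun _ => _) =
  series (fun k => Im ((bessel_coeff nu k)%:C * bessel_arg u ^+ k)))//.
by apply/funext => k; rewrite Im_sum /series /= big_mkord.
Qed.

Lemma cmeasurable_laguerre_bessel_partial N : cmeasurable (laguerre_bessel_partial N).
Proof.
apply: cmeasurableM; first exact: cmeasurable_planar_laguerre.
apply: cmeasurable_sum => k; apply: cmeasurableM; first exact: cmeasurable_cst.
apply: cmeasurableX; apply: cmeasurableM; first exact: cmeasurable_cst.
apply: cmeasurableM; first exact: cmeasurable_cst.
by apply: cmeasurable_conj; exact: cmeasurable_cplx.
Qed.

Lemma cmeasurable_laguerre_bessel : cmeasurable laguerre_bessel.
Proof.
split.
  apply: (measurable_fun_cvg (h := fun N u => Re (laguerre_bessel_partial N u))) => [N|u _].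
    by case: (cmeasurable_laguerre_bessel_partial N).
  by case: (laguerre_bessel_partial_cvg u).
apply: (measurable_fun_cvg (h := fun N u => Im (laguerre_bessel_partial N u))) => [N|u _].
  by case: (cmeasurable_laguerre_bessel_partial N).
by case: (laguerre_bessel_partial_cvg u).
Qed.

Lemma laguerre_bessel_partial_le : exists C : R, forall N u,
  normc (laguerre_bessel_partial N u) <= C * expR (alpha / 12 * normc (cplx u)).
Proof.
have [C hC] := planar_laguerre_le.
have nu0 : 0 < nu + 1 by rewrite -ltrBlDr sub0r.
set kap := Num.min 1 (nu + 1).
have k0 : 0 < kap by rewrite lt_min ltr01.
(* Chosen so that kap x y = alpha^2 |z| |u| / 16 with y = alpha |u| / 24. *)
pose x := 3 / 2 * alpha * normc z / kap.
have x0 : 0 <= x by rewrite divr_ge0 ?(ltW k0)// !mulr_ge0 ?normc_ge0// ltW.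
exists (C * ((Gamma (nu + 1))^-1 * expR x)) => N u.
pose y := alpha / 24 * normc (cplx u).
have y0 : 0 <= y by rewrite mulr_ge0 ?normc_ge0// divr_ge0// ltW.
have sE : normc (bessel_arg u) = kap * x * y.
  rewrite /bessel_arg !normcM normcR normc_conj ger0_norm ?divr_ge0 ?sqr_ge0//.
  by rewrite /x /y; field; rewrite gt_eqF.
have hb := bessel_partial_le N nu_gtN1 x0 y0 sE.
have -> : alpha / 12 * normc (cplx u) = y + y by rewrite /y; field.
rewrite normcM expRD.
have -> : C * ((Gamma (nu + 1))^-1 * expR x) * (expR y * expR y) =
  (C * expR y) * ((Gamma (nu + 1))^-1 * expR x * expR y) by ring.
by apply: ler_pM; rewrite ?normc_ge0// hC.
Qed.

Lemma laguerre_bessel_le : exists C : R, forall u,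
  normc (laguerre_bessel u) <= C * expR (alpha / 12 * normc (cplx u)).
Proof.
(* The bound passes to the limit separately for the real and imaginary parts, which doubles the
   constant. *)
have [C hC] := laguerre_bessel_partial_le; exists (C + C) => u.
have [hr hi] := laguerre_bessel_partial_cvg u.
rewrite (le_trans (normc_le_ReIm _))// mulrDl.
apply: lerD.
  apply: (ler_cvg_to (cvg_norm hr) (cvg_cst _)); apply: nearW => N.
  exact: le_trans (le_Re_normc _) (hC N u).
apply: (ler_cvg_to (cvg_norm hi) (cvg_cst _)); apply: nearW => N.
exact: le_trans (le_Im_normc _) (hC N u).
Qed.

Lemma cintegral_laguerre_bessel :
  cintegrable mu2 (fun u => laguerre_bessel u * (planar_weight alpha nu u)%:C) /\
  cintegral mu2 (fun u => laguerre_bessel u * (planar_weight alpha nu u)%:C) =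
  (moment_const * alpha ^+ n / n`!%:R)%:C * z ^+ n * cexp (- ((alpha / 4)%:C * z)).
Proof.
have [C hC] := laguerre_bessel_le.
have [i _] := cintegral_planar_weight alpha_gt0 nu_gtN1 cmeasurable_laguerre_bessel hC.
split; first exact: i.
have [D hD] := laguerre_bessel_partial_le.
pose I g := cintegral mu2 (fun u => g u * (planar_weight alpha nu u)%:C).
have [cr ci] := cvg_cintegral_planar_weight alpha_gt0 nu_gtN1 cmeasurable_laguerre_bessel_partial
  cmeasurable_laguerre_bessel hD (fun u => (laguerre_bessel_partial_cvg u).1) (fun u => (laguerre_bessel_partial_cvg u).2).
(* One sequence, two limits: dominated convergence gives the integral, the explicit partial sums
   give the exponential. *)
apply: (@ccvg_unique _ (fun N => I (laguerre_bessel_partial (n + N)))).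
  rewrite (_ : (fun _ => _) = fun N => I (laguerre_bessel_partial (N + n))); last first.
    by apply/funext => N; rewrite addnC.
  by split; [rewrite -(cvg_shiftn n) in cr; exact: cr|rewrite -(cvg_shiftn n) in ci; exact: ci].
rewrite (_ : (fun _ => _) = fun N => (moment_const * alpha ^+ n / n`!%:R)%:C * z ^+ n *
    \sum_(k < N) (- ((alpha / 4)%:C * z)) ^+ k / k`!%:R); last first.
  by apply/funext => N; exact: cintegral_laguerre_bessel_partialD.
apply: ccvgMl; have [er ei] := exp_series_cvg (- ((alpha / 4)%:C * z)).
split.
  rewrite (_ : (fun _ => _) =
    series (fun k => Re ((- ((alpha / 4)%:C * z)) ^+ k / k`!%:R)))//.
  by apply/funext => k; rewrite Re_sum /series /= big_mkord.
rewrite (_ : (fun _ => _) =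
  series (fun k => Im ((- ((alpha / 4)%:C * z)) ^+ k / k`!%:R)))//.
by apply/funext => k; rewrite Im_sum /series /= big_mkord.
Qed.

End LaguerreMoments.

(** * Identification of the weight and normalization *)

Section MacdonaldWeight.
Variable R : realType.
Local Notation mu := (@lebesgue_measure R).
Local Notation mu2 := (sfprod mu mu).

(** The integrand is 1, its integral is infinite, and [fine] sends it to 0. This settles the origin
    when nu = 0, where the powers of 0 equal 1. *)
Lemma besselK00 : besselK 0 (0 : R) = 0.
Proof.
rewrite /besselK /= /Rintegral.
rewrite (_ : (fun _ => _) = cst 1%:E); last first.
  by apply/funext => t /=; rewrite !mul0r oppr0 !expR0 mul1r -[2]/(1 + 1) divff// (@pnatr_eq0 R 2).
rewrite integral_cst// mul1e /= lebesgue_measure_itv/= ltry.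
by [].
Qed.

Lemma planar_weightE (alpha nu : R) (u : R * R) : 0 < alpha -> -1 < nu ->
  cpow (cplx u) (nu / 2) *
    (((alpha / 4) `^ nu)%:C * conjc (cpow (sqrtc (cplx u)) nu)) *
    ((expR (- (1 / 6 * alpha * u.1)))%:C
      * (besselK nu (alpha * normc (cplx u) / 3))%:C)
  = ((3 / 2) `^ nu / 2)%:C * (planar_weight alpha nu u)%:C.
Proof.
(* At the origin both sides are 0: the power of 0 vanishes if nu != 0, and K_0(0) does if nu = 0. *)
move=> a0 nu1; have [u0|u0] := eqVneq (cplx u) 0.
  rewrite u0 sqrtc0 !cpow0 normc0 mulr0 mul0r.
  have -> : planar_weight alpha nu u = 0.
    rewrite /planar_weight; under eq_Rintegral => t _.
      rewrite /planar_density -normc_cplxE u0 normc0 expr0n eqxx; over.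
    by rewrite Rintegral_cst ?mul0r.
  rewrite mulr0; have [->|nu0] := eqVneq nu 0; first by rewrite besselK00 !mulr0.
  by rewrite mulf_eq0 invr_eq0 (negbTE nu0) (@pnatr_eq0 R 2) !mul0r.
have r0 := normc_gt0 u0.
set q := alpha / 6 * normc (cplx u).
have q0 : 0 < q by rewrite mulr_gt0 ?divr_gt0.
have -> : planar_weight alpha nu u =
    expR (- (alpha / 6 * u.1)) * (2 * q `^ nu * besselK nu (2 * q)).
  rewrite besselKE// /planar_weight.
  rewrite -(@RintegralZl _ _ _ mu setT _ _ measurableT (@integrable_macdonald_density R nu q q0 nu1)).
  apply: eq_Rintegral => t _; rewrite /planar_density -normc_cplxE.
  by rewrite expf_eq0 /= (gt_eqF r0).
have -> : 2 * q = alpha * normc (cplx u) / 3 by rewrite /q; field.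
have -> : 1 / 6 * alpha * u.1 = alpha / 6 * u.1 by field.
(* 3 / 2 is the ratio of alpha / 4, from the Bessel argument, to alpha / 6, from q. *)
have h : (alpha / 4) `^ nu * normc (cplx u) `^ nu = (3 / 2) `^ nu * q `^ nu.
  rewrite -powRM ?divr_ge0 ?normc_ge0 ?(ltW a0)// -powRM ?(ltW q0)//.
  by congr (_ `^ _); rewrite /q; field.
rewrite [X in X * _]mulrCA cpow_half_conj//.
rewrite -!(rmorphM (real_complex R)) h; congr (_%:C).
by move: (_ `^ _) (_ `^ _) (expR _) (besselK _ _) => A B D E; field.
Qed.

Lemma moment_const_normalization (alpha nu : R) (n : nat) : 0 < alpha ->
  n`!%:R / (3 * pi * 2 `^ (nu + 3) * alpha ^ (n%:Z - 2)) *
    ((3 / 2) `^ nu / 2 * (moment_const alpha nu * alpha ^+ n / n`!%:R)) = 1.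
Proof.
move=> a0; have an : alpha != 0 by rewrite gt_eqF.
have -> : alpha ^ (n%:Z - 2) = alpha ^+ n / alpha ^+ 2.
  by rewrite expfzDr// exprnP.
have -> : (2 : R) `^ (nu + 3) = 2 `^ nu * 8.
  by rewrite powRD ?(@pnatr_eq0 R 2) ?implybT// (powR_mulrn 3)//; congr (_ * _); ring.
rewrite /moment_const.
have -> : (4 / 3 : R) `^ (nu + 1) = (4 / 3) `^ nu * (4 / 3).
  by rewrite powRD ?powRr1//; apply/implyP => _; rewrite gt_eqF.
(* The ratio 3 / 2 of scales and the gamma rate 3 / 4 combine into the 2^nu of the statement. *)
have -> : (2 : R) `^ nu = (3 / 2) `^ nu * (4 / 3) `^ nu.
  by rewrite -powRM//; congr (_ `^ _); field.
have A0 : (3 / 2 : R) `^ nu != 0 by rewrite gt_eqF// powR_gt0.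
have B0 : (4 / 3 : R) `^ nu != 0 by rewrite gt_eqF// powR_gt0.
have f0 : n`!%:R != 0 :> R by rewrite pnatr_eq0 -lt0n fact_gt0.
have e0 : alpha ^+ n != 0 by rewrite expf_neq0.
have p0 : pi != 0 :> R by rewrite gt_eqF// pi_gt0.
move: (_ `^ _) (_ `^ _) (_ ^+ n) pi A0 B0 e0 p0 => A B D E A0 B0 D0 E0.
by field; rewrite A0 B0 D0 E0 f0 an.
Qed.

End MacdonaldWeight.

(* The second identity is the first one with z^(nu/2) = (sqrt z)^nu cancelled;
   for z != 0 they are equivalent, and at z = 0 it is the second one that
   carries the content. *)
Theorem mainTheorem5 (R : realType) (alpha nu : R) (n : nat)
    (alpha_gt0 : 0 < alpha) (nu_gtN1 : -1 < nu) (z : R[i]) :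
  let c : R :=
    n`!%:R / (3 * pi * 2 `^ (nu + 3) * alpha ^ (n%:Z - 2)) in
  let weight (u : R[i]) : R[i] :=
    laguerre nu n (- ((alpha / 4)%:C * u))
    * (expR (- (1 / 6 * alpha * complex.Re u)))%:C
    * (besselK nu (alpha * normc u / 3))%:C in
  let F (u : R[i]) : R[i] :=
    cpow u (nu / 2)
    * besselI nu ((alpha / 2)%:C * (sqrtc z * conjc (sqrtc u)))
    * weight u in
  let F0 (u : R[i]) : R[i] :=
    cpow u (nu / 2)
    * (((alpha / 4) `^ nu)%:C * conjc (cpow (sqrtc u) nu)
       * besselI_entire nu ((alpha ^+ 2 / 16)%:C * (z * conjc u)))
    * weight u in
  [/\ planar_integrable F,
      cpow z (n%:R + nu / 2) * cexp (- ((alpha / 4)%:C * z))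
        = c%:C * planar_integral F,
      planar_integrable F0
    & z ^+ n * cexp (- ((alpha / 4)%:C * z)) = c%:C * planar_integral F0].
Proof.
move=> c weight F F0.
pose mu2 := sfprod (@lebesgue_measure R) (@lebesgue_measure R).
pose G u := laguerre_bessel alpha nu n z u * (planar_weight alpha nu u)%:C.
have F0E u : F0 (cplx u) = ((3 / 2) `^ nu / 2)%:C * G u.
  rewrite /F0 /weight /G /laguerre_bessel /planar_laguerre /bessel_arg /=.
  rewrite [RHS]mulrCA -(planar_weightE u alpha_gt0 nu_gtN1).
  by move: (laguerre _ _ _) (besselI_entire _ _) => A B; rewrite /=; ring.
(* Valid at z = 0 and v = 0 too, so the first identity is the second one multiplied by (sqrt
   z)^nu. *)
have FE v : F v = cpow (sqrtc z) nu * F0 v.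
  rewrite /F /F0 /besselI.
  have -> : (alpha / 2)%:C * (sqrtc z * conjc (sqrtc v)) / 2 =
      (alpha / 4)%:C * (sqrtc z * conjc (sqrtc v)).
    have -> : (alpha / 2)%:C = (alpha / 4)%:C * 2 :> R[i].
      by rewrite -(rmorph_nat (real_complex R) 2) -rmorphM; congr (_%:C); field.
    by rewrite (mulrAC _ 2) mulfK ?(@pnatr_eq0 _ 2).
  rewrite cpow_scaled_sqrt_conj ?divr_gt0//.
  have -> : ((alpha / 2)%:C * (sqrtc z * conjc (sqrtc v))) ^+ 2 / 4 =
      (alpha ^+ 2 / 16)%:C * (z * conjc v).
    rewrite !exprMn -(rmorphXn (@conjc R)) !sqr_sqrtc.
    have -> : (alpha ^+ 2 / 16)%:C = (alpha / 2)%:C ^+ 2 / 4 :> R[i].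
      rewrite -rmorphXn -(rmorph_nat (real_complex R) 4) -fmorphV -rmorphM.
      by congr (_%:C); field.
    by rewrite mulrAC.
  by ring.
have [iG vG] := cintegral_laguerre_bessel n alpha_gt0 nu_gtN1 z.
have iF0 : cintegrable mu2 (fun u => F0 (cplx u)).
  by under eq_fun do rewrite F0E; exact: cintegrableZ.
have vF0 : z ^+ n * cexp (- ((alpha / 4)%:C * z)) = c%:C * planar_integral F0.
  have -> : planar_integral F0 = cintegral mu2 (fun u => F0 (cplx u)) by [].
  have -> : (fun u => F0 (cplx u)) = (fun u => ((3 / 2) `^ nu / 2)%:C * G u).
    by apply/funext => u; exact: F0E.
  rewrite (cintegralZ _ iG) vG; move: (cexp _) => E.
  rewrite !mulrA -!(rmorphM (real_complex R)) -(mulrA c).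
  by rewrite moment_const_normalization// mul1r.
split; [|..|exact: iF0|exact: vF0].
- have : cintegrable mu2 (fun u => F (cplx u)).
    by under eq_fun do rewrite FE; exact: cintegrableZ.
  exact.
- have -> : planar_integral F = cintegral mu2 (fun u => F (cplx u)) by [].
  have -> : (fun u => F (cplx u)) = (fun u => cpow (sqrtc z) nu * F0 (cplx u)).
    by apply/funext => u; exact: FE.
  by rewrite (cintegralZ _ iF0) (cpow_nat_half z n nu_gtN1) mulrAC vF0 -mulrA (mulrC _ (cpow _ _)).
Qed.
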